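(* Work in either the $C^*$-setting or the $W^*$-setting. Let $X=(X(n))_{n\in\mathbb{Z}_+}$ be a standard product system, and let $T$ be a fully coisometric, covariant representation of $X$ on a Hilbert space $\mathcal{H}$. Then $T$ is isometric (in the $C^*$-setting this is equivalent to $T$ extending to a $C^*$-representation) if and only if $$\lim_{\ell\to\infty}\bigl\|(p_\ell\otimes I_{\mathcal{H}})(\eta\otimes\widetilde{T}_{\ell-m}^*h)\bigr\|_{X(\ell)\otimes_\sigma\mathcal{H}}=\|T_m(\eta)h\|_{\mathcal{H}}$$ for all $m\in\mathbb{N}$, $\eta\in X(m)$ and $h\in\mathcal{H}$, where $p_\ell$ is the projection of $E^{\otimes\ell}$ onto $X(\ell)$, which here is the identity $I_{E^{\otimes\ell}}$.
   Context: Conventions. Hilbert spaces are complex; $C^*$-algebras need not be unital; all representations of operator algebras on Hilbert spaces are assumed nondegenerate. $\mathcal{L}(F)$ denotes the adjointable operators on a Hilbert module $F$. Two settings are considered. $C^*$-setting: $\mathcal{M}$ is a $C^*$-algebra; a correspondence over $\mathcal{M}$ is a right Hilbert $C^*$-module $F$ over $\mathcal{M}$ (inner product $\langle\cdot,\cdot\rangle$ linear in the second variable) with a left action $a\zeta=\varphi(a)\zeta$ given by a $*$-homomorphism $\varphi:\mathcal{M}\to\mathcal{L}(F)$; tensor products are interior tensor products. $W^*$-setting: $\mathcal{M}$ is a von Neumann algebra, correspondences are required to be self-dual with $\varphi$ normal, and tensor products and direct sums of correspondences mean the self-dual completions of the usual ones. For a representation $\sigma$ of $\mathcal{M}$ on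 $\mathcal{H}$, $F\otimes_\sigma\mathcal{H}$ is the Hilbert space with $(\zeta_1\otimes h_1,\zeta_2\otimes h_2)=(h_1,\sigma(\langle\zeta_1,\zeta_2\rangle)h_2)$. Standard product system: $X(n)=E^{\otimes n}$ for all $n\in\mathbb{Z}_+$ ($E^{\otimes0}=\mathcal{M}$), where $E$ is a correspondence over $\mathcal{M}$ whose left action is nondegenerate ($\varphi(\mathcal{M})E$ dense in $E$; in the $W^*$-setting, $\varphi$ unital). $X(n)\otimes X(m)$ is identified with $X(n+m)$ (using the module actions if $n$ or $m$ is $0$). Completely contractive, covariant representation of $X$ on $\mathcal{H}$: a family $T=(T_n)_{n\in\mathbb{Z}_+}$ of linear maps $T_n:X(n)\to B(\mathcal{H})$ such that $\sigma:=T_0$ is a $C^*$-representation of $\mathcal{M}$ on $\mathcal{H}$; each $T_n$ is completely contractive (with $X(n)$ viewed inside its linking algebra); $T_n(\zeta a)=T_n(\zeta)\sigma(a)$ and $T_n(a\zeta)=\sigma(a)T_n(\zeta)$; and $T_{n+m}(\zeta\otimes\eta)=T_n(\zeta)T_m(\eta)$ for $\zeta\in X(n),\eta\in X(m)$. In the $W^*$-setting $\sigma$ is also required to be normal, and each $T_n$ continuous from the $\sigma$-topology of $X(n)$ (generated by the functionals $x\mapsto\sum_i\omega_i(\langle\eta_i,x\rangle)$ with $\omega_i\in\mathcal{M}_*$, $\eta_i\in X(n)$, $\sum_i\|\omega_i\|\|\eta_i\|<\infty$) to the ultraweak topology (this continuity is automatic when $\sigma$ is normal). For each $n$, $\widetilde{T}_n:X(n)\otimes_\sigma\mathcal{H}\to\mathcal{H}$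 is the contraction $\widetilde{T}_n(\zeta\otimes h)=T_n(\zeta)h$. $T$ is isometric, respectively fully coisometric, if it is completely contractive and $\widetilde{T}_n$ is isometric, respectively coisometric, for all $n$. Fock space and shift: $\mathcal{F}_X=\bigoplus_{n\in\mathbb{Z}_+}E^{\otimes n}$, and for $\zeta\in X(n)$, $S_n(\zeta)\in\mathcal{L}(\mathcal{F}_X)$ is given by $S_n(\zeta)\eta=\zeta\otimes\eta$. The Toeplitz algebra $\mathcal{T}(X)$ is the $C^*$-subalgebra of $\mathcal{L}(\mathcal{F}_X)$ generated by all $S_n(\zeta)$. $T$ extends to a $C^*$-representation if there is a $C^*$-representation $\pi$ of $\mathcal{T}(X)$ on $\mathcal{H}$ with $\pi(S_n(\zeta))=T_n(\zeta)$ for all $n\in\mathbb{Z}_+$, $\zeta\in X(n)$. *)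

(* Defs.v *)
From mathcomp Require Import all_boot all_order all_algebra.
From mathcomp Require Import complex.
From mathcomp Require Import all_classical all_reals all_analysis.

Set Implicit Arguments.
Unset Strict Implicit.
Unset Printing Implicit Defensive.

Import Order.TTheory GRing.Theory Num.Theory.
Import numFieldNormedType.Exports.

Local Open Scope classical_set_scope.
Local Open Scope ring_scope.

(* A norm on a normedModType over Cx R takes its values in Cx R; as 0 <= z in
   Cx R means that z is real and nonnegative, these are ordinary norms. *)
Definition Cx (R : realType) : numClosedFieldType := R[i].

Definition bddlin {R : realType} {V W : normedModType (Cx R)} (f : V -> W) :=
  linear f /\ continuous f.

Definition lspan {R : realType} {V : lmodType (Cx R)} (A : set V) : set V :=
  [set x | exists (n : nat) (c : 'I_n -> Cx R) (f : 'I_n -> V),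
     (forall i, A (f i)) /\ x = \sum_(i < n) c i *: f i].

Definition total {R : realType} {V : normedModType (Cx R)} (A : set V) :=
  closure (lspan A) = setT.

(* For families Phi, Psi of linear functionals on V, W: continuity of a linear
   map V -> W, and density of a subset of V, for the locally convex topologies
   generated by Phi and Psi. *)
Definition weak_continuous {R : realType} {V W : Type}
    (Phi : set (V -> Cx R)) (Psi : set (W -> Cx R)) (t : V -> W) :=
  forall psi, Psi psi -> forall e : Cx R, 0 < e ->
    exists (n : nat) (f : 'I_n -> V -> Cx R) (d : Cx R),
      [/\ forall i, Phi (f i), 0 < d &
          forall x, (forall i, `|f i x| < d) -> `|psi (t x)| < e].

Definition weak_dense {R : realType} {V : zmodType}
    (Phi : set (V -> Cx R)) (A : set V) :=
  forall (z : V) (n : nat) (f : 'I_n -> V -> Cx R) (e : Cx R),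
    (forall i, Phi (f i)) -> 0 < e ->
    exists2 y, A y & forall i, `|f i (y - z)| < e.

(* The inner product is linear in the second variable. *)
Record hilbert (R : realType) := Hilbert {
  hilbert_car :> completeNormedModType (Cx R);
  ip : hilbert_car -> hilbert_car -> Cx R;
  ip_add : forall x y z, ip x (y + z) = ip x y + ip x z;
  ip_scale : forall (c : Cx R) x y, ip x (c *: y) = c * ip x y;
  ip_conj : forall x y, ip y x = (ip x y)^*;
  ip_norm : forall x, ip x x = `|x| ^+ 2 }.

Definition adjoint {R : realType} {H K : hilbert R} (A : H -> K) (B : K -> H) :=
  forall x y, ip (A x) y = ip x (B y).

(* The ultraweakly continuous functionals on B(H); operators are functions
   H -> H satisfying bddlin, and values elsewhere are irrelevant. *)
Definition ultraweak {R : realType} (H : hilbert R) : set ((H -> H) -> Cx R) :=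
  [set psi | exists k l : nat -> H,
     [/\ cvgn (series (fun i => `|k i| ^+ 2)),
         cvgn (series (fun i => `|l i| ^+ 2)) &
         forall A : H -> H, bddlin A ->
           series (fun i => ip (k i) (A (l i))) @ \oo --> psi A]].

(* Not necessarily unital C*-algebras. *)
Record cstar (R : realType) := CStar {
  cstar_car :> completeNormedModType (Cx R);
  cmul : cstar_car -> cstar_car -> cstar_car;
  cadj : cstar_car -> cstar_car;
  cmulA : forall a b c, cmul a (cmul b c) = cmul (cmul a b) c;
  cmul_linr : forall a, linear (cmul a);
  cmul_linl : forall b, linear (cmul^~ b);
  cadj_add : forall a b, cadj (a + b) = cadj a + cadj b;
  cadj_scale : forall (c : Cx R) a, cadj (c *: a) = c^* *: cadj a;
  cadjK : involutive cadj;
  cadjM : forall a b, cadj (cmul a b) = cmul (cadj b) (cadj a);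
  cnormM : forall a b, `|cmul a b| <= `|a| * `|b|;
  cnorm_cstar : forall a, `|cmul (cadj a) a| = `|a| ^+ 2 }.

Record star_rep {R : realType} {M : cstar R} {H : hilbert R}
    (s : M -> H -> H) : Prop := StarRep {
  star_rep_bdd : forall a, bddlin (s a);
  star_rep_lin : forall h, linear (s^~ h);
  star_rep_mul : forall a b h, s (cmul a b) h = s a (s b h);
  star_rep_adj : forall a, adjoint (s a) (s (cadj a)) }.

Definition nondegenerate {R : realType} {M : cstar R} {H : hilbert R}
    (s : M -> H -> H) := total [set x | exists a h, x = s a h].

(* A realisation of M as a von Neumann algebra: a faithful representation whose
   image contains, hence equals, its double commutant. *)
Record vNalg (R : realType) (M : cstar R) := VNalg {
  vn_space : hilbert R;
  vn_rep : M -> vn_space -> vn_space;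
  vn_star_rep : star_rep vn_rep;
  vn_faithful : injective vn_rep;
  vn_bicommutant : forall B : vn_space -> vn_space, bddlin B ->
    (forall D : vn_space -> vn_space, bddlin D ->
       (forall a, D \o vn_rep a = vn_rep a \o D) -> B \o D = D \o B) ->
    exists a, vn_rep a = B }.
Arguments vn_rep {R M} v _ _.

Variant setting (R : realType) (M : cstar R) :=
  | Cstar_setting
  | Wstar_setting of vNalg M.
Arguments Cstar_setting {R M}.

(* The predual of M. *)
Definition normal_functional {R : realType} {M : cstar R} (v : vNalg M) :
    set (M -> Cx R) :=
  [set om | exists2 psi, ultraweak psi & forall a, om a = psi (vn_rep v a)].

(* Right Hilbert C*-modules. *)
Record hmod (R : realType) (M : cstar R) := HMod {
  hmod_car :> completeNormedModType (Cx R);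
  hact : hmod_car -> M -> hmod_car;
  hip : hmod_car -> hmod_car -> M;
  hact_linr : forall x, linear (hact x);
  hact_linl : forall a, linear (hact^~ a);
  hactM : forall x a b, hact x (cmul a b) = hact (hact x a) b;
  hip_lin : forall x, linear (hip x);
  hip_act : forall x y a, hip x (hact y a) = cmul (hip x y) a;
  hip_adj : forall x y, cadj (hip x y) = hip y x;
  hip_pos : forall x, exists b, hip x x = cmul (cadj b) b;
  hip_norm : forall x, `|hip x x| = `|x| ^+ 2 }.

Definition hadjoint {R : realType} {M : cstar R} {F G : hmod M}
    (A : F -> G) (B : G -> F) := forall x y, hip (A x) y = hip x (B y).

Definition adjointable {R : realType} {M : cstar R} {F G : hmod M}
    (A : F -> G) := exists B : G -> F, hadjoint A B.

Record corr (R : realType) (M : cstar R) := Corr {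
  corr_hmod :> hmod M;
  lact : M -> corr_hmod -> corr_hmod;
  lact_lin : forall x, linear (lact^~ x);
  lactM : forall a b x, lact (cmul a b) x = lact a (lact b x);
  lact_adj : forall a, hadjoint (lact a) (lact (cadj a)) }.

Section SelfCorrespondence.
Variables (R : realType) (M : cstar R).

Lemma self_hip_lin (x : M) : linear (fun y => cmul (cadj x) y).
Proof. exact: cmul_linr. Qed.

Lemma self_hip_act (x y a : M) :
  cmul (cadj x) (cmul y a) = cmul (cmul (cadj x) y) a.
Proof. exact: cmulA. Qed.

Lemma self_hip_adj (x y : M) : cadj (cmul (cadj x) y) = cmul (cadj y) x.
Proof. by rewrite cadjM cadjK. Qed.

Lemma self_hip_pos (x : M) : exists b, cmul (cadj x) x = cmul (cadj b) b.
Proof. by exists x. Qed.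

Definition self_hmod : hmod M :=
  @HMod R M M (@cmul R M) (fun x y => cmul (cadj x) y)
    (@cmul_linr R M) (@cmul_linl R M) (@cmulA R M)
    self_hip_lin self_hip_act self_hip_adj self_hip_pos (@cnorm_cstar R M).

Lemma self_lactM (a b x : M) : cmul (cmul a b) x = cmul a (cmul b x).
Proof. by rewrite cmulA. Qed.

Lemma self_lact_adj (a : M) :
  @hadjoint R M self_hmod self_hmod (cmul a) (cmul (cadj a)).
Proof. by move=> x y; rewrite /= cadjM cmulA. Qed.

(* M as a correspondence over itself. *)
Definition self_corr : corr M :=
  @Corr R M self_hmod (@cmul R M) (@cmul_linl R M) self_lactM self_lact_adj.

End SelfCorrespondence.

Definition self_dual {R : realType} {M : cstar R} (F : hmod M) :=
  forall f : F -> M, bddlin f -> (forall x a, f (hact x a) = cmul (f x) a) ->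
  exists y, forall x, f x = hip y x.

(* The functionals generating the sigma-topology of F; c i bounds the norm of
   om i. *)
Definition sigma_functional {R : realType} {M : cstar R} (v : vNalg M)
    (F : hmod M) : set (F -> Cx R) :=
  [set f | exists (om : nat -> M -> Cx R) (eta : nat -> F) (c : nat -> Cx R),
     [/\ forall i, normal_functional v (om i),
         forall i a, `|om i a| <= c i * `|a|,
         cvgn (series (fun i => c i * `|eta i|)) &
         forall x, series (fun i => om i (hip (eta i) x)) @ \oo --> f x]].

(* The ultraweakly continuous functionals on L(F), for F self-dual. *)
Definition module_ultraweak {R : realType} {M : cstar R} (v : vNalg M)
    (F : hmod M) : set ((F -> F) -> Cx R) :=
  [set psi | exists (om : nat -> M -> Cx R) (x y : nat -> F) (c : nat -> Cx R),
     [/\ forall i, normal_functional v (om i),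
         forall i a, `|om i a| <= c i * `|a|,
         cvgn (series (fun i => c i * `|x i| * `|y i|)) &
         forall A : F -> F, adjointable A ->
           series (fun i => om i (hip (x i) (A (y i)))) @ \oo --> psi A]].

Definition corr_in {R : realType} {M : cstar R} (W : setting M) (F : corr M) :=
  if W is Wstar_setting v then
    self_dual F /\
    weak_continuous (normal_functional v) (@module_ultraweak R M v F)
      (@lact R M F)
  else True.

Definition total_in {R : realType} {M : cstar R} (W : setting M) (F : hmod M)
    (A : set F) :=
  if W is Wstar_setting v then weak_dense (@sigma_functional R M v F) (lspan A)
  else total A.

Definition lact_nondegenerate {R : realType} {M : cstar R} (W : setting M)
    (E : corr M) :=
  if W is Wstar_setting v then
    forall u, vn_rep v u = id -> forall x : E, lact u x = x
  else total [set z : E | exists a x, z = lact a x].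

(* t : F x G -> Z exhibits Z as the tensor product of F and G over M: the
   interior one in the C*-setting, its self-dual completion (when Z satisfies
   corr_in) in the W*-setting. *)
Record is_tensor {R : realType} {M : cstar R} (W : setting M) {F G Z : corr M}
    (t : F -> G -> Z) : Prop := IsTensor {
  tensor_linr : forall x, linear (t x);
  tensor_linl : forall y, linear (t^~ y);
  tensor_hip : forall x x' y y',
    hip (t x y) (t x' y') = hip y (lact (hip x x') y');
  tensor_lact : forall a x y, lact a (t x y) = t (lact a x) y;
  tensor_hact : forall x y a, hact (t x y) a = t x (hact y a);
  tensor_total : total_in W [set z | exists x y, z = t x y] }.

Definition ps_fiber {R : realType} {M : cstar R} (E : nat -> corr M) (n : nat) :
    corr M := if n is n'.+1 then E n' else self_corr M.

(* Standard product systems: X(0) = M, X(1) = E, and psmul identifies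
   X(n) (x) X(m) with X(n + m), compatibly with iterated products; thus X(n) is
   the n-th tensor power of E. *)
Record product_system (R : realType) (M : cstar R) (W : setting M) := PS {
  ps_pos : nat -> corr M;
  ps_corr_in : forall n, corr_in W (ps_fiber ps_pos n);
  ps_nondegenerate : lact_nondegenerate W (ps_fiber ps_pos 1);
  psmul : forall n m,
    ps_fiber ps_pos n -> ps_fiber ps_pos m -> ps_fiber ps_pos (n + m);
  psmul_tensor : forall n m, is_tensor W (@psmul n m);
  psmul0x : forall m (a : M) (x : ps_fiber ps_pos m),
    @psmul 0 m a x = lact a x;
  psmulx0 : forall n (x : ps_fiber ps_pos n) (a : M),
    ecast k (ps_fiber ps_pos k) (addn0 n) (@psmul n 0 x a) = hact x a;
  psmulA : forall n m k (x : ps_fiber ps_pos n) (y : ps_fiber ps_pos m)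
      (z : ps_fiber ps_pos k),
    ecast j (ps_fiber ps_pos j) (addnA n m k) (psmul x (psmul y z)) =
    psmul (psmul x y) z }.

Definition ps_module {R : realType} {M : cstar R} {W : setting M}
  (X : product_system W) (n : nat) : corr M := ps_fiber (ps_pos X) n.
Coercion ps_module : product_system >-> Funclass.

(* c bounds the norm of the matrix z over F, where F = K(M, F) is a corner of its
   linking algebra: z acts from the column module M^k to F^k. *)
Definition mx_norm_le {R : realType} {M : cstar R} {F : hmod M} {k : nat}
    (z : 'M[F]_k) (c : Cx R) :=
  forall b : 'I_k -> M,
    let y i := \sum_(j < k) hact (z i j) (b j) in
    `|\sum_(i < k) hip (y i) (y i)| <=
      c ^+ 2 * `|\sum_(j < k) cmul (cadj (b j)) (b j)|.

Definition op_mx_norm_le {R : realType} {H : hilbert R} {k : nat}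
    (A : 'M[H -> H]_k) (c : Cx R) :=
  forall h : 'I_k -> H,
    \sum_(i < k) `|\sum_(j < k) A i j (h j)| ^+ 2 <=
      c ^+ 2 * \sum_(j < k) `|h j| ^+ 2.

Definition completely_contractive {R : realType} {M : cstar R} {F : hmod M}
    {H : hilbert R} (t : F -> H -> H) :=
  forall (k : nat) (z : 'M[F]_k) (c : Cx R), 0 <= c ->
    mx_norm_le z c -> op_mx_norm_le (\matrix_(i, j) t (z i j)) c.

Record covariant_rep {R : realType} {M : cstar R} {W : setting M}
    (X : product_system W) (H : hilbert R) (T : forall n, X n -> H -> H) :
    Prop := CovariantRep {
  rep_bdd : forall n (x : X n), bddlin (T n x);
  rep_lin : forall n h, linear (fun x : X n => T n x h);
  rep_star : @star_rep R M H (T 0%N);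
  rep_nondegenerate : @nondegenerate R M H (T 0%N);
  rep_cc : forall n, completely_contractive (T n);
  rep_hact : forall n (x : X n) (a : M) h, T n (hact x a) h = T n x (T 0%N a h);
  rep_lact : forall n (a : M) (x : X n) h, T n (lact a x) h = T 0%N a (T n x h);
  rep_mul : forall n m (x : X n) (y : X m) h,
    T (n + m)%N (psmul x y) h = T n x (T m y h);
  rep_normal : if W is Wstar_setting v then
      weak_continuous (normal_functional v) (@ultraweak R H) (T 0%N) /\
      forall n, weak_continuous (@sigma_functional R M v (X n))
                  (@ultraweak R H) (T n)
    else True }.

(* A Hilbert space K = F (x)_s H with its elementary tensors; these data are
   unique up to a unitary compatible with the elementary tensors. *)
Record hilbert_tensor (R : realType) (M : cstar R) (F : hmod M) (H : hilbert R)
    (s : M -> H -> H) := HilbertTensor {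
  ht_space :> hilbert R;
  ht : F -> H -> ht_space;
  ht_linr : forall x, linear (ht x);
  ht_linl : forall h, linear (ht^~ h);
  ht_ip : forall x x' h h', ip (ht x h) (ht x' h') = ip h (s (hip x x') h');
  ht_total : total [set z | exists x h, z = ht x h] }.
Arguments ht {R M F H s} h _ _ : rename.

Section Representations.
Variables (R : realType) (M : cstar R) (W : setting M) (X : product_system W).
Variables (H : hilbert R) (T : forall n, X n -> H -> H).
Variable K : forall n, hilbert_tensor (X n) (T (n := 0%N)).

(* Such a t is unique, by totality of the elementary tensors. *)
Definition is_tilde n (t : K n -> H) :=
  [/\ linear t, forall z, `|t z| <= `|z| &
      forall (x : X n) h, t (ht (K n) x h) = T x h].

(* The identification of X(m) (x) (X(k) (x)_s H) with X(m + k) (x)_s H, as the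
   bilinear map (eta, xi) |-> eta (x) xi; also unique. *)
Definition is_absorb m k (f : X m -> K k -> K (m + k)%N) :=
  forall eta : X m, bddlin (f eta) /\
    forall (x : X k) h, f eta (ht (K k) x h) = ht (K (m + k)%N) (psmul eta x) h.

Definition isometric_rep (Tt : forall n, K n -> H) :=
  covariant_rep T /\ forall n (z : K n), `|Tt n z| = `|z|.

(* Ts n is meant to be the adjoint of Tt n. *)
Definition fully_coisometric_rep (Tt : forall n, K n -> H)
    (Ts : forall n, H -> K n) :=
  covariant_rep T /\ forall n h, Tt n (Ts n h) = h.

End Representations.

(* The C*-direct sum of all X(n), which the orthogonality and density conditions
   determine up to unitary equivalence, with the operators S_n(x), which
   fock_shift_in determines. *)
Record fock_space (R : realType) (M : cstar R) (W : setting M)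
    (X : product_system W) := FockSpace {
  fock_car :> hmod M;
  fock_in : forall n, X n -> fock_car;
  fock_in_lin : forall n, linear (@fock_in n);
  fock_in_act : forall n (x : X n) a, fock_in (hact x a) = hact (fock_in x) a;
  fock_in_hip : forall n (x y : X n), hip (fock_in x) (fock_in y) = hip x y;
  fock_in_orth : forall n m (x : X n) (y : X m), n != m ->
    hip (fock_in x) (fock_in y) = 0;
  fock_total : total [set z | exists n (x : X n), z = fock_in x];
  fock_shift : forall n, X n -> fock_car -> fock_car;
  fock_shift_adj : forall n (x : X n), adjointable (fock_shift x);
  fock_shift_in : forall n m (x : X n) (y : X m),
    fock_shift x (fock_in y) = fock_in (psmul x y) }.
Arguments fock_shift {R M W X} f [n] _ _.

Record cstar_subalgebra {R : realType} {M : cstar R} (F : hmod M)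
    (Q : set (F -> F)) : Prop := CstarSubalgebra {
  sub_adjointable : forall A, Q A -> adjointable A;
  sub0 : Q (fun=> 0);
  subD : forall A B, Q A -> Q B -> Q (fun x => A x + B x);
  subZ : forall (c : Cx R) A, Q A -> Q (fun x => c *: A x);
  subM : forall A B, Q A -> Q B -> Q (A \o B);
  sub_adj : forall A B, Q A -> hadjoint A B -> Q B;
  sub_closed : forall A, adjointable A ->
    (forall e : Cx R, 0 < e ->
       exists2 B, Q B & forall x, `|A x - B x| <= e * `|x|) -> Q A }.

(* The C*-subalgebra of L(F) generated by the S_n(x). *)
Definition toeplitz {R : realType} {M : cstar R} {W : setting M}
    {X : product_system W} (F : fock_space X) : set (F -> F) :=
  \bigcap_(Q in [set Q : set (F -> F) | cstar_subalgebra Q /\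
                   forall n (x : X n), Q (fock_shift F x)]) Q.

(* Nondegenerate *-representations of the Toeplitz algebra; values of pi outside
   of it are irrelevant. *)
Record toeplitz_rep {R : realType} {M : cstar R} {W : setting M}
    {X : product_system W} (F : fock_space X) (H : hilbert R)
    (pi : (F -> F) -> H -> H) : Prop := ToeplitzRep {
  trep_bdd : forall A, toeplitz A -> bddlin (pi A);
  trepD : forall A B, toeplitz A -> toeplitz B ->
    forall h, pi (fun x => A x + B x) h = pi A h + pi B h;
  trepZ : forall (c : Cx R) A, toeplitz A ->
    forall h, pi (fun x => c *: A x) h = c *: pi A h;
  trepM : forall A B, toeplitz A -> toeplitz B ->
    forall h, pi (A \o B) h = pi A (pi B h);
  trep_adj : forall A B, toeplitz A -> hadjoint A B -> adjoint (pi A) (pi B);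
  trep_nondegenerate :
    total [set z | exists2 A, toeplitz A & exists h, z = pi A h] }.

Definition extends_to_toeplitz {R : realType} {M : cstar R} {W : setting M}
    {X : product_system W} (F : fock_space X) (H : hilbert R)
    (T : forall n, X n -> H -> H) :=
  exists2 pi : (F -> F) -> H -> H, toeplitz_rep pi &
    forall n (x : X n), pi (fock_shift F x) = T n x.

(* Main.v *)
(* Write U_n for the adjoint of T_n~, so that T_n~ U_n = 1.  Since
   <eta (x) U_k h, eta (x) U_k h> = <U_k h, (<eta, eta> (x) 1) U_k h> and T_k~
   intertwines a (x) 1 with sigma(a), the norm of eta (x) U_k h is that of
   eta (x) h for every k.  The sequence in the limit condition is therefore
   constant, and the condition says that T_m~ preserves the norm of elementary
   tensors.  As T_m~ is a contraction, this means U_m T_m~ z = z for elementary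
   tensors z, hence for all z by linearity.

   If T extends to the Toeplitz algebra, the relation S(x)^* S(y) = S(<x, y>) on
   the Fock space shows that T is isometric.  Conversely, if T is isometric, the
   U_n are unitary, and the isometries
   V_N h = (N + 1)^(-1/2) (U_0 h + ... + U_N h) from the Hilbert space of T to
   (Fock space) (x)_sigma H satisfy (A (x) 1) V_N h - V_N pi(A) h -> 0 for
   A = S(x) and A = S(x)^*, with pi(A) = T(x) and pi(A) = T(x)^*.  The A for which
   such a pi(A) exists, together with one for A^*, form a C*-algebra, so pi is
   defined on the whole Toeplitz algebra; it is a representation because the
   limit determines pi(A). *)
From HB Require Import structures.
Require Import Defs.
From mathcomp Require Import all_boot all_order all_algebra.
From mathcomp Require Import complex ring lra.
From mathcomp Require Import all_classical all_reals all_analysis.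

Set Implicit Arguments.
Unset Strict Implicit.
Unset Printing Implicit Defensive.

Import Order.TTheory GRing.Theory Num.Theory.
Import numFieldNormedType.Exports.

Local Open Scope classical_set_scope.
Local Open Scope ring_scope.

(** * Real parts and norms of complex scalars *)

Section ComplexScalars.
Variable R : realType.
Implicit Types (r s : R) (z w : Cx R).

Definition cre z : R := complex.Re z.
Definition cof r : Cx R := r%:C%C.
(* The norm, which takes its values in [Cx R], as an element of [R]. *)
Definition rnorm {V : normedZmodType (Cx R)} (x : V) : R := cre `|x|.

Lemma creD z w : cre (z + w) = cre z + cre w.
Proof. by case: z w => [a b] [c d]. Qed.

Lemma creN z : cre (- z) = - cre z.
Proof. by case: z. Qed.

Lemma creB z w : cre (z - w) = cre z - cre w.
Proof. by rewrite creD creN. Qed.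

Lemma cofD r s : cof (r + s) = cof r + cof s.
Proof. exact: rmorphD. Qed.

Lemma cofM r s : cof (r * s) = cof r * cof s.
Proof. exact: rmorphM. Qed.

Lemma cofX r n : cof (r ^+ n) = cof r ^+ n.
Proof. exact: rmorphXn. Qed.

Lemma cof_nat n : cof n%:R = n%:R.
Proof. exact: (rmorph_nat (real_complex R)). Qed.

Lemma cre_cof r : cre (cof r) = r.
Proof. by []. Qed.

Lemma creZ r z : cre (cof r * z) = r * cre z.
Proof. by case: z => a b; rewrite /cre /= mul0r subr0. Qed.

Lemma conjE z : z^* = (z^*)%C.
Proof. by []. Qed.

Lemma cre_conj z : cre z^* = cre z.
Proof. by rewrite conjE; case: z. Qed.

Lemma conj_cof r : (cof r)^* = cof r.
Proof. by rewrite conjE /cof conjc_real. Qed.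

Lemma cof_ge0 r : (0 <= cof r) = (0 <= r).
Proof. exact: ler0c. Qed.

Lemma le_cof r s : (cof r <= cof s) = (r <= s).
Proof. exact: lecR. Qed.

Lemma lt_cof r s : (cof r < cof s) = (r < s).
Proof. exact: ltcR. Qed.

Lemma cre_ge0K z : 0 <= z -> z = cof (cre z).
Proof. by move=> /ger0_real z0; rewrite /cof /cre RRe_real. Qed.

Lemma gt0_cof (e : Cx R) : 0 < e -> exists2 r, 0 < r & e = cof r.
Proof.
move=> e0; have eE := cre_ge0K (ltW e0); exists (cre e) => //.
by move: e0; rewrite eE -[0]/(cof 0) lt_cof.
Qed.

Section Norm.
Variable V : normedZmodType (Cx R).
Implicit Types x y : V.

Lemma rnormE x : `|x| = cof (rnorm x).
Proof. exact: cre_ge0K. Qed.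

Lemma rnorm_ge0 x : 0 <= rnorm x.
Proof. by rewrite -cof_ge0 -rnormE. Qed.

Lemma rnormD x y : rnorm (x + y) <= rnorm x + rnorm y.
Proof. by rewrite -le_cof cofD -!rnormE ler_normD. Qed.

Lemma rnormN x : rnorm (- x) = rnorm x.
Proof. by rewrite /rnorm normrN. Qed.

Lemma rnormB x y : rnorm (x - y) = rnorm (y - x).
Proof. by rewrite -opprB rnormN. Qed.

Lemma rnorm0 : rnorm (0 : V) = 0.
Proof. by rewrite /rnorm normr0. Qed.

Lemma rnorm_eq0 x : rnorm x = 0 -> x = 0.
Proof. by move=> x0; apply/normr0_eq0; rewrite rnormE x0. Qed.

Lemma rnorm_sum I (s : seq I) (F : I -> V) :
  rnorm (\sum_(i <- s) F i) <= \sum_(i <- s) rnorm (F i).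
Proof.
elim: s => [|i s IH]; first by rewrite !big_nil rnorm0.
by rewrite !big_cons (le_trans (rnormD _ _)) ?lerD2l.
Qed.

End Norm.

Lemma rnormM z w : rnorm (z * w) = rnorm z * rnorm w.
Proof. by rewrite /rnorm normrM !rnormE -cofM. Qed.

Lemma rnormZ (V : normedModType (Cx R)) z (x : V) :
  rnorm (z *: x) = rnorm z * rnorm x.
Proof. by rewrite /rnorm normrZ !rnormE -cofM. Qed.

Lemma rnorm_conj z : rnorm z^* = rnorm z.
Proof. by rewrite /rnorm norm_conjC. Qed.

Lemma rnorm_cof r : rnorm (cof r) = `|r|.
Proof.
by rewrite /rnorm normc_def /= expr0n addr0 sqrtr_sqr.
Qed.

Lemma cre_le z : `|cre z| <= rnorm z.
Proof. by rewrite -le_cof -rnormE; exact: normc_ge_Re. Qed.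

Lemma cre_le_rnorm z : cre z <= rnorm z.
Proof. exact: le_trans (ler_norm _) (cre_le z). Qed.

Lemma mulC_conj z : z * z^* = cof (rnorm z ^+ 2).
Proof. by rewrite -normCK rnormE cofX. Qed.

(* The hypothesis is [0 <= |u + c v|^2] with [a = |u|^2], [b = |v|^2], [z = <u, v>]. *)
Lemma cauchy_schwarz_scalar (a b : R) z : 0 <= a -> 0 <= b ->
  (forall c, 0 <= a + 2 * cre (c * z) + rnorm c ^+ 2 * b) ->
  rnorm z ^+ 2 <= a * b.
Proof.
move=> a0 b0 pos; have z0 := rnorm_ge0 z.
(* This phase makes [c t * z] equal to [-t |z|^2], so the hypothesis becomes a real quadratic
   inequality in [t]. *)
pose c t : Cx R := cof (- t) * z^*.
have cz t : cre (c t * z) = - t * rnorm z ^+ 2.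
  by rewrite /c -mulrA [z^* * z]mulrC mulC_conj -cofM cre_cof.
have nc t : rnorm (c t) ^+ 2 = t ^+ 2 * rnorm z ^+ 2.
  by rewrite /c rnormM rnorm_cof rnorm_conj exprMn -normrX sqrrN ger0_norm ?sqr_ge0.
have {}pos t : 0 <= a - 2 * t * rnorm z ^+ 2 + t ^+ 2 * rnorm z ^+ 2 * b.
  by have := pos (c t); rewrite cz nc; lra.
set u := rnorm z ^+ 2 in pos *; have [bE|bn0] := eqVneq b 0.
  (* For [b = 0] the inequality is affine in [t], and [t = (a + 1) / u] violates it unless
     [u = 0]. *)
  rewrite bE mulr0; have [->//|un0] := eqVneq u 0.
  have tu : (a + 1) / u * u = a + 1 by rewrite divfK.
  by have := pos ((a + 1) / u); rewrite bE; move: tu; set t := _ / u; lra.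
have bV : b^-1 * b = 1 by rewrite mulVf.
(* For [b > 0] the quadratic is smallest at [t = 1 / b]. *)
have := pos b^-1; set t := b^-1 in bV *.
have -> : t ^+ 2 * u * b = (t * b) * (t * u) by ring.
rewrite bV mul1r => h; have : 0 <= b * (a - t * u) by apply: mulr_ge0 => //; lra.
by have -> : b * (a - t * u) = a * b - (t * b) * u; [ring|rewrite bV mul1r subr_ge0].
Qed.

(** Cancels one factor in estimates such as [|B y|^2 <= |B y| (C |y|)]; [0 <= b] covers the case
    [a = 0]. *)
Lemma ler_of_sqr_le (a b : R) : 0 <= a -> 0 <= b -> a ^+ 2 <= a * b -> a <= b.
Proof.
move=> a0 b0; have [->//|an0] := eqVneq a 0.
by rewrite expr2 ler_pM2l // lt_def an0.
Qed.

End ComplexScalars.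

(** * Density, Hilbert spaces and Hilbert modules *)

Section Density.
Variable R : realType.

Section LinearFunctions.
Variables (V W : lmodType (Cx R)) (f : V -> W).
Hypothesis f_lin : linear f.

Lemma lin_add : {morph f : x y / x + y}.
Proof. by move=> x y; have := f_lin 1 x y; rewrite !scale1r. Qed.

Lemma lin0 : f 0 = 0.
Proof. by apply: (@addrI _ (f 0)); rewrite -lin_add !addr0. Qed.

Lemma lin_scale c x : f (c *: x) = c *: f x.
Proof. by have := f_lin c x 0; rewrite lin0 !addr0. Qed.

Lemma lin_opp x : f (- x) = - f x.
Proof. by rewrite -(scaleN1r x) lin_scale scaleN1r. Qed.

Lemma lin_sum I (s : seq I) (P : pred I) (F : I -> V) :
  f (\sum_(i <- s | P i) F i) = \sum_(i <- s | P i) f (F i).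
Proof. exact: (big_morph f lin_add lin0). Qed.

End LinearFunctions.

Lemma bddlin_bound (V W : normedModType (Cx R)) (f : V -> W) :
  bddlin f -> exists2 C, 0 <= C & forall x, rnorm (f x) <= C * rnorm x.
Proof.
case=> lf cf; pose g : {linear V -> W} := HB.pack f (GRing.isLinear.Build _ _ _ _ f lf).
have /linear_boundedP/pinfty_ex_gt0[_ /gt0_cof[C C0 ->] Cg] := (linear_bounded_continuous g).2 cf.
by exists C => [|x]; [exact: ltW|rewrite -le_cof cofM -!rnormE; exact: Cg].
Qed.

Lemma bound_bddlin (V W : normedModType (Cx R)) (f : V -> W) C :
  linear f -> (forall x, rnorm (f x) <= C * rnorm x) -> bddlin f.
Proof.
move=> lf Cf; split=> //.
pose g : {linear V -> W} := HB.pack f (GRing.isLinear.Build _ _ _ _ f lf).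
apply: (bounded_linear_continuous (f := g)); apply/linear_boundedP.
near=> r => x; apply: (@le_trans _ _ (cof C * `|x|)).
  by rewrite !rnormE -cofM le_cof; exact: Cf.
by apply: ler_wpM2r => //; near: r; apply: nbhs_pinfty_ge; rewrite complex_real.
Unshelve. all: by end_near. Qed.

Lemma closure_rnorm (V : normedModType (Cx R)) (A : set V) x e :
  closure A x -> 0 < e -> exists2 y, A y & rnorm (x - y) <= e.
Proof.
move=> clx e0; have ce0 : 0 < cof e by rewrite -[0]/(cof 0) lt_cof.
have [y [Ay]] := clx _ (nbhsx_ballx x (cof e) ce0).
by rewrite -ball_normE /= rnormE lt_cof => /ltW ?; exists y.
Qed.

Lemma rnorm_closure (V : normedModType (Cx R)) (A : set V) x :
  (forall e, 0 < e -> exists2 y, A y & rnorm (x - y) <= e) -> closure A x.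
Proof.
move=> h B /nbhs_ballP[_ /= /gt0_cof[e e0 ->]] eB.
have [y Ay xy] := h (e / 2) (divr_gt0 e0 (ltr0Sn _ 1)).
exists y; split=> //; apply: eB; rewrite -ball_normE /= rnormE lt_cof.
by apply: le_lt_trans xy _; lra.
Qed.

Section Total.
Variables (V : normedModType (Cx R)) (A : set V).
Hypothesis A_total : Defs.total A.

Lemma total_approx x e : 0 < e -> exists2 y, lspan A y & rnorm (x - y) <= e.
Proof. by apply: closure_rnorm; rewrite A_total. Qed.

Lemma lspan_ind (P : V -> Prop) : P 0 -> (forall x y, P x -> P y -> P (x + y)) ->
  (forall c x, P x -> P (c *: x)) -> (forall x, A x -> P x) ->
  forall x, lspan A x -> P x.
Proof.
move=> P0 PD PZ PA x [n [c [f [Af ->]]]].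
by apply: (big_ind P) => // i _; apply/PZ/PA/Af.
Qed.

Lemma total_ind (P : V -> Prop) : P 0 -> (forall x y, P x -> P y -> P (x + y)) ->
  (forall c x, P x -> P (c *: x)) -> (forall x, A x -> P x) ->
  (forall x, (forall e, 0 < e -> exists2 y, P y & rnorm (x - y) <= e) -> P x) ->
  forall x, P x.
Proof.
move=> P0 PD PZ PA Pcl x; apply: Pcl => e /(total_approx x)[y Ay xy].
by exists y => //; apply: lspan_ind Ay.
Qed.

(** Homogeneity is asked only for the zero set, so that the lemma also applies to conjugate-linear
    maps such as an inner product in its first variable. *)
Lemma eq0_on_total (W : normedZmodType (Cx R)) (f : V -> W) C :
  {morph f : x y / x + y} -> (forall c x, f x = 0 -> f (c *: x) = 0) ->
  (forall x, rnorm (f x) <= C * rnorm x) -> (forall x, A x -> f x = 0) ->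
  forall x, f x = 0.
Proof.
move=> fD fZ fC f0; have {fC}fC x : rnorm (f x) <= `|C| * rnorm x.
  by apply: le_trans (fC x) _; rewrite ler_wpM2r ?rnorm_ge0 ?ler_norm.
apply: (total_ind (P := fun x => f x = 0)) => //.
- by apply: rnorm_eq0; apply/le_anti; rewrite rnorm_ge0 -[X in _ <= X](mulr0 `|C|) -(rnorm0 V) fC.
- by move=> x y fx fy; rewrite fD fx fy addr0.
move=> x h; apply: rnorm_eq0; apply/le_anti; rewrite rnorm_ge0 andbT.
apply/ler_addgt0Pr => e e0; rewrite add0r; have C1 : 0 < `|C| + 1 by rewrite ltr_wpDl.
have [y fy xy] := h _ (divr_gt0 e0 C1); rewrite -[x](subrK y) fD fy addr0.
apply: le_trans (fC _) _; apply: (@le_trans _ _ ((`|C| + 1) * (e / (`|C| + 1)))).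
  by apply: ler_pM => //; [exact: rnorm_ge0|rewrite lerDl].
by rewrite mulrC divfK ?gt_eqF.
Qed.

Lemma bddlin_eq_on_total (W : normedModType (Cx R)) (f g : V -> W) :
  bddlin f -> bddlin g -> (forall x, A x -> f x = g x) -> forall x, f x = g x.
Proof.
move=> bf bg fg x; have [[C C0 fC] [D D0 gD]] := (bddlin_bound bf, bddlin_bound bg).
apply/eqP; rewrite -subr_eq0; apply/eqP; move: x.
apply: (@eq0_on_total _ (fun x => f x - g x) (C + D)).
- by move=> x y; rewrite (lin_add bf.1) (lin_add bg.1) opprD addrACA.
- by move=> c x fg0; rewrite (lin_scale bf.1) (lin_scale bg.1) -scalerBr fg0 scaler0.
- move=> x; rewrite mulrDl; apply: le_trans (rnormD _ _) _; rewrite rnormN lerD //.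
- by move=> x Ax; rewrite fg ?subrr.
Qed.

End Total.
End Density.

Section HilbertSpace.
Variables (R : realType) (H : hilbert R).
Implicit Types (x y z : H) (c : Cx R).

Lemma ip_addl x y z : ip (x + y) z = ip x z + ip y z.
Proof. by rewrite ip_conj ip_add rmorphD /= -!ip_conj. Qed.

Lemma ip_scalel c x y : ip (c *: x) y = c^* * ip x y.
Proof. by rewrite ip_conj ip_scale rmorphM /= -ip_conj. Qed.

Lemma ip0r x : ip x 0 = 0.
Proof. by rewrite -(scale0r (0 : H)) ip_scale mul0r. Qed.

Lemma ip0l x : ip 0 x = 0.
Proof. by rewrite ip_conj ip0r rmorph0. Qed.

Lemma ipNr x y : ip x (- y) = - ip x y.
Proof. by rewrite -(scaleN1r y) ip_scale mulN1r. Qed.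

Lemma ipNl x y : ip (- x) y = - ip x y.
Proof. by rewrite ip_conj ipNr rmorphN /= -ip_conj. Qed.

Lemma ip_suml I (s : seq I) (P : pred I) (F : I -> H) y :
  ip (\sum_(i <- s | P i) F i) y = \sum_(i <- s | P i) ip (F i) y.
Proof. by elim/big_rec2: _ => [|i u v _ <-]; rewrite ?ip0l ?ip_addl. Qed.

Lemma ip_sumr I (s : seq I) (P : pred I) (F : I -> H) y :
  ip y (\sum_(i <- s | P i) F i) = \sum_(i <- s | P i) ip y (F i).
Proof. by elim/big_rec2: _ => [|i u v _ <-]; rewrite ?ip0r ?ip_add. Qed.

Lemma ip_rnorm x : ip x x = cof (rnorm x ^+ 2).
Proof. by rewrite ip_norm rnormE cofX. Qed.

Lemma ip_CS x y : rnorm (ip x y) <= rnorm x * rnorm y.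
Proof.
rewrite -(ler_pXn2r (n := 2)) ?nnegrE ?mulr_ge0 ?rnorm_ge0 // exprMn.
apply: cauchy_schwarz_scalar; rewrite ?sqr_ge0 // => c.
have : 0 <= cre (ip (x + c *: y) (x + c *: y)) by rewrite ip_rnorm cre_cof sqr_ge0.
rewrite !(ip_add, ip_addl, ip_scale, ip_scalel) !ip_rnorm mulrA mulC_conj.
rewrite -cofM !creD !cre_cof; have -> : cre (c^* * ip y x) = cre (c * ip x y).
  by rewrite [ip y x]ip_conj -rmorphM cre_conj.
by lra.
Qed.

End HilbertSpace.

Section HilbertModule.
Variables (R : realType) (M : cstar R).

Lemma hip_addr (F : hmod M) (x y z : F) : hip x (y + z) = hip x y + hip x z.
Proof. by have := hip_lin x 1 y z; rewrite !scale1r. Qed.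

Lemma hip_scaler (F : hmod M) (x y : F) c : hip x (c *: y) = c *: hip x y.
Proof.
have h0 : hip x 0 = 0 by apply: (@addrI _ (hip x 0)); rewrite -hip_addr !addr0.
by have := hip_lin x c y 0; rewrite !addr0 h0 addr0.
Qed.

Lemma hip_addl (F : hmod M) (x y z : F) : hip (x + y) z = hip x z + hip y z.
Proof. by rewrite -hip_adj hip_addr cadj_add !hip_adj. Qed.

Lemma hip_scalel (F : hmod M) (x y : F) c : hip (c *: x) y = c^* *: hip x y.
Proof. by rewrite -hip_adj hip_scaler cadj_scale hip_adj. Qed.

Lemma hip0r (F : hmod M) (x : F) : hip x 0 = 0.
Proof. by rewrite -(scale0r (0 : F)) hip_scaler scale0r. Qed.

Lemma hip0l (F : hmod M) (x : F) : hip 0 x = 0.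
Proof. by rewrite -(scale0r (0 : F)) hip_scalel conjE conjc0 scale0r. Qed.

Lemma hipNr (F : hmod M) (x y : F) : hip x (- y) = - hip x y.
Proof. by rewrite -(scaleN1r y) hip_scaler scaleN1r. Qed.

Lemma hipNl (F : hmod M) (x y : F) : hip (- x) y = - hip x y.
Proof. by rewrite -(scaleN1r x) hip_scalel rmorphN rmorph1 scaleN1r. Qed.

Lemma hip_rnorm (F : hmod M) (x : F) : rnorm (hip x x) = rnorm x ^+ 2.
Proof. by rewrite /rnorm hip_norm [`|x|]rnormE -cofX. Qed.

Lemma hip_eq0 (F : hmod M) (x : F) : hip x x = 0 -> x = 0.
Proof.
move=> x0; apply: rnorm_eq0; apply/eqP.
by rewrite -sqrf_eq0 -hip_rnorm x0 rnorm0.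
Qed.

Lemma eq_hip (F : hmod M) (x y : F) : (forall z, hip x z = hip y z) -> x = y.
Proof.
move=> h; apply/eqP; rewrite -subr_eq0; apply/eqP/hip_eq0.
by rewrite hip_addl hipNl h subrr.
Qed.

(* Polarization replaces the Cauchy-Schwarz inequality of Hilbert modules,
   which would need positivity in M; the constant 4 is harmless. *)
Lemma hip_bound (F : hmod M) (x y : F) : rnorm (hip x y) <= 4 * rnorm x * rnorm y.
Proof.
have pol (u v : F) : rnorm (hip u v) <= (rnorm u + rnorm v) ^+ 2.
  have hD (c : Cx R) : rnorm c = 1 -> rnorm (hip (u + c *: v) (u + c *: v)) <=
      (rnorm u + rnorm v) ^+ 2.
    move=> c1; rewrite hip_rnorm ler_pXn2r ?nnegrE ?addr_ge0 ?rnorm_ge0 //.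
    by apply: le_trans (rnormD _ _) _; rewrite rnormZ c1 mul1r.
  pose i : Cx R := 'i%C.
  have ni : rnorm i = 1.
    by rewrite /rnorm normc_def /= expr0n add0r expr1n sqrtr1.
  have ci : i^* = - i by rewrite conjE /i /=; congr Complex; rewrite oppr0.
  have ii : i * i = -1 by rewrite -expr2; exact: sqr_i.
  pose Q (c : Cx R) := hip (u + c *: v) (u + c *: v).
  (* [L] records coefficients with respect to the four inner products of [u] and [v], which turns
     the polarization identity into arithmetic of coefficients. *)
  pose L (p q r s : Cx R) := p *: hip u u + q *: hip u v + (r *: hip v u + s *: hip v v).
  have LD p q r s p' q' r' s' : L p q r s + L p' q' r' s' = L (p + p') (q + q') (r + r') (s + s').
    by rewrite /L !scalerDl addrACA [X in X + _]addrACA [X in _ + X]addrACA.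
  have LZ k p q r s : k *: L p q r s = L (k * p) (k * q) (k * r) (k * s).
    by rewrite /L !scalerDr !scalerA.
  have QL c : Q c = L 1 c c^* (c^* * c).
    rewrite /Q /L scale1r !(hip_addl, hip_addr, hip_scaler, hip_scalel) !scalerA.
    by rewrite [c * c^*]mulrC.
  have c1 : (1 : Cx R)^* = 1 by rewrite rmorph1.
  have cN1 : (-1 : Cx R)^* = -1 by rewrite rmorphN1.
  have cNi : (- i)^* = i by rewrite rmorphN /= ci opprK.
  have E : (4 : Cx R) *: hip u v = Q 1 + (-1 : Cx R) *: Q (-1) + (- i) *: Q i + i *: Q (- i).
    rewrite !QL c1 cN1 ci cNi !LZ !LD.
    have -> : (4 : Cx R) *: hip u v = L 0 4 0 0 by rewrite /L !scale0r add0r !addr0.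
    congr L; rewrite ?mulrN ?mulNr ?mulrN ?mulrA ?ii ?mulr1 ?mul1r ?mulNr ?mulr1 ?opprK ?ii; ring.
  have : rnorm ((4 : Cx R) *: hip u v) <= 4 * (rnorm u + rnorm v) ^+ 2.
    rewrite E; have := rnormD (Q 1 + (-1 : Cx R) *: Q (-1) + (- i) *: Q i) (i *: Q (- i)).
    have := rnormD (Q 1 + (-1 : Cx R) *: Q (-1)) ((- i) *: Q i).
    have := rnormD (Q 1) ((-1 : Cx R) *: Q (-1)).
    have n1 : rnorm (1 : Cx R) = 1 by rewrite (rnorm_cof 1) normr1.
    have nN1 : rnorm (-1 : Cx R) = 1 by rewrite rnormN.
    have nNi : rnorm (- i) = 1 by rewrite rnormN.
    rewrite !rnormZ ni nNi nN1 !mul1r.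
    have := hD 1 n1; have := hD i ni; have := hD (-1) nN1; have := hD (- i) nNi.
    rewrite -!/(Q _); lra.
  rewrite -[4 : Cx R]cof_nat.
  by rewrite rnormZ rnorm_cof ger0_norm // ler_pM2l.
have sc (t : R) (u : F) : rnorm (cof t *: u) = `|t| * rnorm u by rewrite rnormZ rnorm_cof.
have [x0|x0] := eqVneq (rnorm x) 0.
  by rewrite (rnorm_eq0 x0) hip0l !rnorm0 mulr0 mul0r.
have [y0|y0] := eqVneq (rnorm y) 0.
  by rewrite (rnorm_eq0 y0) hip0r !rnorm0 mulr0.
have xp : 0 < rnorm x by rewrite lt_def x0 rnorm_ge0.
have yp : 0 < rnorm y by rewrite lt_def y0 rnorm_ge0.
(* On normalized vectors the polarization bound is [(1 + 1)^2 = 4]. *)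
have := pol (cof (rnorm x)^-1 *: x) (cof (rnorm y)^-1 *: y).
rewrite hip_scalel hip_scaler conj_cof !rnormZ !rnorm_cof !normfV.
rewrite !(ger0_norm (rnorm_ge0 _)) !mulVf // => h.
have -> : rnorm (hip x y) = rnorm x * rnorm y * ((rnorm x)^-1 * ((rnorm y)^-1 * rnorm (hip x y))).
  by field; rewrite x0 y0.
have -> : 4 * rnorm x * rnorm y = rnorm x * rnorm y * 4 by ring.
rewrite ler_pM2l ?mulr_gt0 //.
by apply: le_trans h _; lra.
Qed.

Lemma hadjointC (F G : hmod M) (A : F -> G) (B : G -> F) : hadjoint A B -> hadjoint B A.
Proof. by move=> AB x y; rewrite -hip_adj -AB hip_adj. Qed.

Lemma hadjoint_uniq (F G : hmod M) (A : F -> G) (B B' : G -> F) :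
  hadjoint A B -> hadjoint A B' -> B = B'.
Proof.
by move=> AB AB'; apply/funext => y; apply: eq_hip => z; rewrite !(hadjointC AB, hadjointC AB').
Qed.

(** [|B y|^2 = |<A B y, y>|], and [hip_bound] contributes the factor 4. *)
Lemma hadjoint_bound (F G : hmod M) (A : F -> G) (B : G -> F) C : 0 <= C ->
  hadjoint A B -> (forall x, rnorm (A x) <= C * rnorm x) ->
  forall y, rnorm (B y) <= 4 * C * rnorm y.
Proof.
move=> C0 AB AC y; apply: ler_of_sqr_le; rewrite ?rnorm_ge0 ?mulr_ge0 ?rnorm_ge0 //.
rewrite -hip_rnorm -AB; apply: le_trans (hip_bound _ _) _.
have := ler_wpM2r (rnorm_ge0 y) (AC (B y)); lra.
Qed.

End HilbertModule.

(** * The limit condition *)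

(** The defect of linearity is paired with itself, and every [B] in the second variable is moved
    across to [A]. *)
Lemma adjoint_linear (R : realType) (H K : hilbert R) (A : H -> K) (B : K -> H) :
  adjoint A B -> linear B.
Proof.
move=> AB c x y; apply/eqP; rewrite -subr_eq0; apply/eqP/rnorm_eq0/eqP.
rewrite -sqrf_eq0 -[X in X == _]cre_cof -ip_rnorm ip_add ipNr ip_add ip_scale -!AB.
by rewrite ip_add ip_scale subrr.
Qed.

Section Tilde.
Variables (R : realType) (M : cstar R) (W : setting M) (X : product_system W).
Variables (H : hilbert R) (T : forall n, X n -> H -> H).
Variable K : forall n, hilbert_tensor (X n) (T (n := 0%N)).
Variables (Tt : forall n, K n -> H) (Ts : forall n, H -> K n).
Hypothesis Tt_tilde : forall n, is_tilde (@Tt n).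
Hypothesis Ts_adjoint : forall n, adjoint (@Tt n) (@Ts n).
Hypothesis T_coisometric : fully_coisometric_rep (@Tt) (@Ts).

Let T_rep : covariant_rep (@T) := T_coisometric.1.

Lemma tilde_contractive n (z : K n) : rnorm (Tt z) <= rnorm z.
Proof. by have [_ c _] := Tt_tilde n; rewrite -le_cof -!rnormE. Qed.

Lemma tilde_bddlin n : bddlin (@Tt n).
Proof.
have [l _ _] := Tt_tilde n; apply: (bound_bddlin (C := 1)) => // z.
by rewrite mul1r tilde_contractive.
Qed.

Lemma tilde_ht n (x : X n) h : Tt (ht (K n) x h) = T x h.
Proof. by have [_ _ ->] := Tt_tilde n. Qed.

Lemma tilde_adj_norm n h : rnorm (Ts n h) = rnorm h.
Proof.
apply/eqP; rewrite -(eqrXn2 (n := 2)) ?rnorm_ge0 // -[X in X == _]cre_cof.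
by rewrite -ip_rnorm -Ts_adjoint T_coisometric.2 ip_rnorm cre_cof.
Qed.

(** As [Tt] is coisometric, [|Ts (Tt z) - z|^2 = |z|^2 - |Tt z|^2]. *)
Lemma tilde_adjK n (z : K n) : rnorm (Tt z) = rnorm z -> Ts n (Tt z) = z.
Proof.
move=> zz; apply/eqP; rewrite -subr_eq0; apply/eqP/rnorm_eq0/eqP.
rewrite -sqrf_eq0 -[X in X == _]cre_cof -ip_rnorm ip_add !ip_addl !(ipNl, ipNr).
rewrite -!Ts_adjoint [ip (Ts _ _) z]ip_conj -Ts_adjoint T_coisometric.2.
by rewrite !ip_rnorm conj_cof zz opprK addrA subrK subrr.
Qed.

(** Preservation of norms does not pass from elementary tensors to their sums, but the linear
    identity [Ts (Tt z) = z] does. *)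
Lemma tilde_isometric n :
  (forall (x : X n) h, rnorm (T x h) = rnorm (ht (K n) x h)) ->
  forall z : K n, rnorm (Tt z) = rnorm z.
Proof.
move=> Txh; have lTs := adjoint_linear (Ts_adjoint (n := n)).
have TsK : forall z : K n, Ts n (Tt z) = z.
  apply: (bddlin_eq_on_total (ht_total (K n)) (f := Ts n \o @Tt n) (g := id)).
  - apply: (bound_bddlin (C := 1)) => [c u v|z] /=.
      by rewrite (tilde_bddlin n).1 lTs.
    by rewrite tilde_adj_norm mul1r tilde_contractive.
  - by apply: (bound_bddlin (C := 1)) => // z; rewrite mul1r.
  - by move=> _ [x [h ->]] /=; apply: tilde_adjK; rewrite tilde_ht.
by move=> z; rewrite -[in RHS](TsK z) tilde_adj_norm.
Qed.

(** The counterpart for [T] of the relation [S(x)^* S(y) = S(<x, y>)] between shifts. *)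
Lemma isometric_ip n : (forall z : K n, rnorm (Tt z) = rnorm z) ->
  forall (x y : X n) h g, ip (T x h) (T y g) = ip h (T (hip x y : X 0) g).
Proof. by move=> iso x y h g; rewrite -(tilde_ht x) -(tilde_ht y) Ts_adjoint tilde_adjK ?ht_ip. Qed.

(** [Ts k h] is approximated by a sum of elementary tensors, and the contraction [Tt] carries it
    back to [h]. The list holds the terms of that sum. *)
Lemma coisometric_dense k h e : 0 < e -> exists w : seq (X k * H),
  rnorm (\sum_(a <- w) T a.1 a.2 - h) <= e.
Proof.
move=> e0; have [y ys hy] := total_approx (ht_total (K k)) (Ts k h) e0.
have lT := (tilde_bddlin k).1.
have [w wE] : exists w : seq (X k * H), Tt y = \sum_(a <- w) T a.1 a.2.
  apply: (lspan_ind (P := fun y => exists w, Tt y = \sum_(a <- w) T a.1 a.2) _ _ _ _ ys) => {hy ys y}.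
  - by exists [::]; rewrite big_nil (lin0 lT).
  - by move=> y z [v vE] [w wE]; exists (v ++ w); rewrite big_cat (lin_add lT) vE wE.
  - move=> c y [w wE]; exists [seq (c *: a.1, a.2) | a <- w].
    rewrite (lin_scale lT) wE big_map scaler_sumr; apply: eq_bigr => a _ /=.
    by rewrite (lin_scale (rep_lin T_rep a.2)).
  by move=> _ [x [g ->]]; exists [:: (x, g)]; rewrite big_seq1 tilde_ht.
exists w; rewrite -wE -[X in _ - X](T_coisometric.2 k) -(lin_opp lT) -(lin_add lT).
by apply: le_trans (tilde_contractive _) _; rewrite rnormB.
Qed.

Section Absorb.
Variable absorb : forall m k, X m -> K k -> K (m + k)%N.
Hypothesis absorb_spec : forall m k, is_absorb (@absorb m k).

(** For [m = 0] this is the intertwining of [a (x) 1] with [sigma(a)]. *)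
Lemma tilde_absorb m k (eta : X m) (z : K k) :
  Tt (absorb eta z) = T eta (Tt z).
Proof.
have [_ abs_ht] := absorb_spec k eta; have [al ac] := (absorb_spec k eta).1.
have [bl bc] := rep_bdd T_rep eta.
apply: (bddlin_eq_on_total (ht_total (K k)) (f := @Tt _ \o absorb eta) (g := T eta \o @Tt k)).
- split=> [c u v|]; first by rewrite /= al (tilde_bddlin _).1.
  move=> u; apply: continuous_comp; [exact: ac|exact: (tilde_bddlin _).2].
- split=> [c u v|]; first by rewrite /= (tilde_bddlin _).1 bl.
  move=> u; apply: continuous_comp; [exact: (tilde_bddlin _).2|exact: bc].
by move=> _ [x [h ->]] /=; rewrite abs_ht !tilde_ht (rep_mul T_rep).
Qed.

(** On elementary tensors this is the inner product formula of [X(m) (x) X(k)], with the left action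
    written as absorption of a degree 0 element. Both sides are bounded sesquilinear, so density is
    used in one variable at a time. *)
Lemma absorb_ip m k (eta : X m) (z z' : K k) :
  ip (absorb eta z) (absorb eta z') = ip z (absorb (hip eta eta : X 0) z').
Proof.
have [ba abs_ht] := absorb_spec k eta.
have [b0 abs0] := absorb_spec k (hip eta eta : X 0).
have [[C C0 Ca] [D D0 Da]] := (bddlin_bound ba, bddlin_bound b0).
apply/eqP; rewrite -subr_eq0; apply/eqP; move: z.
pose f (z z' : K k) : Cx R := ip (absorb eta z) (absorb eta z') - ip z (absorb (hip eta eta : X 0) z').
have fb z w : rnorm (f z w) <= (C ^+ 2 + D) * rnorm z * rnorm w.
  apply: le_trans (rnormD _ _) _; rewrite rnormN.
  apply: le_trans (lerD (ip_CS _ _) (ip_CS _ _)) _.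
  have := ler_pM (rnorm_ge0 _) (rnorm_ge0 _) (Ca z) (Ca w).
  have := ler_wpM2l (rnorm_ge0 z) (Da w); lra.
apply: (@eq0_on_total _ _ _ (ht_total (K k)) _ (f^~ z') ((C ^+ 2 + D) * rnorm z')).
- by move=> u v; rewrite /f (lin_add ba.1) !ip_addl opprD addrACA.
- move=> c u fu; rewrite /f (lin_scale ba.1) !ip_scalel -mulrBr -/(f _ _) fu.
  exact: mulr0.
- by move=> u; rewrite mulrAC.
move=> _ [x [h ->]]; move: z'.
apply: (@eq0_on_total _ _ _ (ht_total (K k)) _ (f _) ((C ^+ 2 + D) * rnorm (ht (K k) x h))).
- by move=> u v; rewrite /f (lin_add ba.1) (lin_add b0.1) !ip_add opprD addrACA.
- move=> c u fu; rewrite /f (lin_scale ba.1) (lin_scale b0.1) !ip_scale -mulrBr -/(f _ _) fu.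
  exact: mulr0.
- by move=> u.
move=> _ [y [g ->]]; rewrite /f abs0 !abs_ht !ht_ip psmul0x.
by rewrite (tensor_hip (psmul_tensor X m k)) subrr.
Qed.

Lemma absorb_tilde_adj_norm m k (eta : X m) h :
  rnorm (absorb eta (Ts k h)) = rnorm (ht (K m) eta h).
Proof.
apply/eqP; rewrite -(eqrXn2 (n := 2)) ?rnorm_ge0 //.
rewrite -[X in X == _]cre_cof -[X in _ == X]cre_cof -!ip_rnorm absorb_ip ht_ip.
rewrite ip_conj -(Ts_adjoint (n := k)).
by rewrite [Tt _](tilde_absorb (hip eta eta : X 0) (Ts k h)) T_coisometric.2 -ip_conj.
Qed.

Lemma isometric_iff_limit :
  isometric_rep (@Tt) <->
    forall m : nat, (0 < m)%N -> forall (eta : X m) (h : H),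
      (fun l => `|absorb eta (Ts (l - m)%N h)|) @ \oo --> `|T eta h|.
Proof.
(* This holds for all [l]: when [l < m] the truncated difference is 0, and the norm is independent
   of the degree [l - m] anyway. *)
have absE m eta h : (fun l => `|absorb eta (Ts (l - m)%N h)|) =
    fun=> `|ht (K m) eta h|.
  by apply/funext => l; rewrite !rnormE absorb_tilde_adj_norm.
split=> [[_ iso] m _ eta h|lim].
  by rewrite absE -tilde_ht iso; exact: cvg_cst.
split=> // -[|n] z; rewrite !rnormE; congr cof; apply: tilde_isometric => x h.
  (* The limit condition says nothing about degree 0; there [|sigma(a) h|^2 = <h, sigma(a^* a) h>]
     because [sigma] is a star representation. *)
  apply/eqP; rewrite -(eqrXn2 (n := 2)) ?rnorm_ge0 //.
  rewrite -[X in X == _]cre_cof -[X in _ == X]cre_cof -!ip_rnorm ht_ip.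
  by rewrite (star_rep_adj (rep_star T_rep)) -(star_rep_mul (rep_star T_rep)).
have := lim n.+1 isT x h; rewrite absE => /(cvg_unique _) E.
apply: complexI; rewrite -!/(cof _) -!rnormE; apply: E; last exact: cvg_cst.
exact: norm_hausdorff.
Qed.

End Absorb.
End Tilde.

(** * Shifts on the Fock space *)

Section FockShift.
Variables (R : realType) (M : cstar R) (W : setting M) (X : product_system W).
Variable F : fock_space X.

Let F_total := fock_total F.

(** Between Fock vectors of different degrees both sides vanish by orthogonality; in equal degrees
    the identity is the inner product formula of the tensor product. *)
Lemma shift_adj_shift n (x y : X n) (B : F -> F) : hadjoint (fock_shift F x) B ->
  B \o fock_shift F y = fock_shift F (hip x y : X 0).
Proof.
move=> SB; have [B' SB'] := fock_shift_adj F y.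
have [B0 SB0] := fock_shift_adj F (hip x y : X 0).
pose w v := B (fock_shift F y v) - fock_shift F (hip x y : X 0) v.
suff w0 v : w v = 0 by apply/funext => v; apply/eqP; rewrite -subr_eq0 /= -/(w v) w0.
have w_in m (z : X m) : w (fock_in F z) = 0.
  apply: hip_eq0; move: {1}(w _).
  apply: (@eq0_on_total _ _ _ F_total M (fun u : F => hip u (w (fock_in F z)))
    (4 * rnorm (w (fock_in F z)))).
  - by move=> u u1; rewrite hip_addl.
  - by move=> k u h; rewrite hip_scalel h scaler0.
  - by move=> u; rewrite mulrAC hip_bound.
  move=> _ [k [t ->]]; rewrite /w hip_addr hipNr -SB !fock_shift_in psmul0x.
  have [e|km] := eqVneq k m; last by rewrite !fock_in_orth ?eqn_add2l // subrr.
  by case: m / e z => z; rewrite !fock_in_hip (tensor_hip (psmul_tensor X n k)) subrr.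
(* The defect [w] has an adjoint, so [<u, w t>] is bounded and linear in [t], and its vanishing
   extends from homogeneous [t] to all [t]. *)
have wE u t : hip u (w t) = hip (B' (fock_shift F x u) - B0 u) t.
  rewrite /w hip_addr hipNr -SB -(hadjointC SB0) -[hip (_ _ u) _](hadjointC SB').
  by rewrite hip_addl hipNl.
suff wt b t : hip b (w t) = 0 by exact: hip_eq0.
pose c := B' (fock_shift F x b) - B0 b; rewrite wE -/c; move: t.
apply: (@eq0_on_total _ _ _ F_total M (hip c) (4 * rnorm c)).
- by move=> u u1; rewrite hip_addr.
- by move=> k u h; rewrite hip_scaler h scaler0.
- by move=> u; rewrite hip_bound.
by move=> _ [k [t ->]]; rewrite -wE w_in hip0r.
Qed.

Lemma toeplitz_shift n (x : X n) : toeplitz (fock_shift F x).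
Proof. by move=> Q [_ QS]; exact: QS. Qed.

Lemma toeplitz_adj A B : toeplitz (F := F) A -> hadjoint A B -> toeplitz B.
Proof. by move=> tA AB Q QP; have [Qsub _] := QP; apply: (sub_adj Qsub) AB; exact: tA. Qed.

Lemma toeplitz_comp A B : toeplitz (F := F) A -> toeplitz B -> toeplitz (A \o B).
Proof. by move=> tA tB Q QP; have [Qsub _] := QP; apply: (subM Qsub); [exact: tA|exact: tB]. Qed.

Lemma toeplitz_add A B : toeplitz (F := F) A -> toeplitz B -> toeplitz (fun x => A x + B x).
Proof. by move=> tA tB Q QP; have [Qsub _] := QP; apply: (subD Qsub); [exact: tA|exact: tB]. Qed.

Lemma toeplitz_scale c A : toeplitz (F := F) A -> toeplitz (fun x => c *: A x).
Proof. by move=> tA Q QP; have [Qsub _] := QP; apply: (subZ Qsub); exact: tA. Qed.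

Lemma toeplitz_rep_ip (H : hilbert R) (T : forall n, X n -> H -> H) :
  extends_to_toeplitz F T -> forall n (x y : X n) h g,
  ip (T n x h) (T n y g) = ip h (T 0%N (hip x y) g).
Proof.
case=> pi pi_rep piT n x y h g; have [B SB] := fock_shift_adj F x.
rewrite -(piT _ x) -(piT _ y) (trep_adj pi_rep (toeplitz_shift x) SB).
rewrite -(trepM pi_rep) ?(shift_adj_shift y SB) ?piT //.
- exact: toeplitz_adj (toeplitz_shift x) SB.
- exact: toeplitz_shift.
Qed.

End FockShift.

(** * Algebraic tensor products as lists *)

(* Applied to [x m = |A^m u|] with [A] self-adjoint, where the second hypothesis
   is the Cauchy-Schwarz inequality; only the crude bound depends on [u]. *)
Lemma sqr_growth_le (R : realType) (x : nat -> R) (C r : R) :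
  0 < r -> (forall m, 0 <= x m) -> (forall m, x m ^+ 2 <= x 0%N * x m.*2) ->
  (forall m, x m <= C * r ^+ m) -> x 1%N <= r * x 0%N.
Proof.
move=> r0 x_ge0 x_sqr x_le; rewrite leNgt; apply/negP => x1.
have [x00|x00] := eqVneq (x 0%N) 0.
  have := x_sqr 1%N; move: x1; rewrite x00 mulr0 mul0r => /(exprn_gt0 2); lra.
have x0p : 0 < x 0%N by rewrite lt_def x00 x_ge0.
(* If the claim fails then [t > 1]. Repeated doubling of the index gives [t ^ (2 ^ j) * x 0 <= C]
   for all [j], which contradicts Bernoulli's inequality. *)
pose t := x 1%N / (r * x 0%N).
have t1 : 1 < t by rewrite /t ltr_pdivlMr ?mul1r ?mulr_gt0.
have x1E : x 1%N = t * r * x 0%N.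
  by rewrite /t; field; rewrite x00 gt_eqF.
have grow j : (t * r) ^+ (2 ^ j) * x 0%N <= x (2 ^ j)%N.
  elim: j => [|j IH]; first by rewrite expr1 -x1E.
  have y0 : 0 <= (t * r) ^+ (2 ^ j) by rewrite exprn_ge0 // mulr_ge0 ?(ltW r0) //; lra.
  rewrite expnSr muln2 -addnn exprD addnn -(ler_pM2l x0p); apply: le_trans (x_sqr _).
  have := ler_pM (mulr_ge0 y0 (ltW x0p)) (mulr_ge0 y0 (ltW x0p)) IH IH.
  by rewrite -expr2; apply: le_trans; rewrite le_eqVlt; apply/orP; left; apply/eqP; ring.
have tC j : t ^+ (2 ^ j) * x 0%N <= C.
  have := le_trans (grow j) (x_le _); rewrite exprMn mulrAC ler_pM2r //.
  exact: exprn_gt0.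
have bern n : 1 + n%:R * (t - 1) <= t ^+ n.
  elim: n => [|n IH]; first by rewrite mul0r addr0.
  rewrite exprS -natr1; have n0 : 0 <= n%:R :> R by [].
  have t0 : 0 <= t by lra.
  have := mulr_ge0 n0 (sqr_ge0 (t - 1)).
  have := ler_wpM2l t0 IH; lra.
have [n nC] : exists n : nat, C / x 0%N / (t - 1) < n%:R.
  exists (Num.bound `|C / x 0%N / (t - 1)|); apply: le_lt_trans (ler_norm _) _.
  exact: archi_boundP.
have t10 : 0 < t - 1 by lra.
move: nC; rewrite !ltr_pdivrMr // => nC.
have : n%:R * (t - 1) <= (2 ^ n)%:R * (t - 1).
  by rewrite ler_pM2r // ler_nat ltnW // ltn_expl.
move=> /(ler_wpM2r (ltW x0p)); have := ler_wpM2r (ltW x0p) (bern (2 ^ n)%N).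
have := tC n; lra.
Qed.

Section PreTensor.
Variables (R : realType) (M : cstar R) (F : hmod M) (H : hilbert R).
Variable s : M -> H -> H.
Hypothesis s_rep : star_rep s.
Hypothesis s_contr : forall a h, rnorm (s a h) <= rnorm a * rnorm h.

(* A list of pairs stands for the sum of its elementary tensors in F (x)_s H;
   this avoids completing the tensor product. *)
Notation pt := (seq (F * H)).
Implicit Types (u v w : pt) (c : Cx R) (A : F -> F).

Definition pip u v : Cx R :=
  \sum_(a <- u) \sum_(b <- v) ip a.2 (s (hip a.1 b.1) b.2).

Definition psc c u : pt := [seq (a.1, c *: a.2) | a <- u].

(** Represents the operator [A (x) 1]. *)
Definition pop A u : pt := [seq (A a.1, a.2) | a <- u].

Lemma pip_catl u v w : pip (u ++ v) w = pip u w + pip v w.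
Proof. by rewrite /pip big_cat. Qed.

Lemma pip_catr u v w : pip w (u ++ v) = pip w u + pip w v.
Proof. by rewrite /pip -big_split; apply: eq_bigr => a _; rewrite big_cat. Qed.

Lemma pip_nill v : pip [::] v = 0.
Proof. exact: big_nil. Qed.

Lemma pip_scr c u v : pip u (psc c v) = c * pip u v.
Proof.
rewrite /pip mulr_sumr; apply: eq_bigr => a _; rewrite big_map mulr_sumr.
by apply: eq_bigr => b _ /=; rewrite (lin_scale (star_rep_bdd s_rep _).1) ip_scale.
Qed.

Lemma pip_scl c u v : pip (psc c u) v = c^* * pip u v.
Proof.
rewrite /pip mulr_sumr big_map; apply: eq_bigr => a _; rewrite mulr_sumr.
by apply: eq_bigr => b _ /=; rewrite ip_scalel.
Qed.

Lemma pip_conj u v : pip v u = (pip u v)^*.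
Proof.
rewrite /pip exchange_big /= rmorph_sum; apply: eq_bigr => a _.
rewrite rmorph_sum; apply: eq_bigr => b _ /=.
by rewrite -ip_conj (star_rep_adj s_rep) hip_adj.
Qed.

Lemma pip_pop A B u v : hadjoint A B -> pip (pop A u) v = pip u (pop B v).
Proof.
move=> AB; rewrite /pip big_map; apply: eq_bigr => a _; rewrite big_map.
by apply: eq_bigr => b _ /=; rewrite AB.
Qed.

Lemma pip_popD A B u v : pip (pop (fun x => A x + B x) u) v = pip (pop A u) v + pip (pop B u) v.
Proof.
rewrite /pip !big_map -big_split; apply: eq_bigr => a _ /=; rewrite -big_split.
apply: eq_bigr => b _ /=; rewrite hip_addl -ip_add.
by have := star_rep_lin s_rep b.2 1 (hip (A a.1) b.1) (hip (B a.1) b.1); rewrite !scale1r => ->.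
Qed.

Lemma pip_popZ A c u v : pip (pop (fun x => c *: A x) u) v = c^* * pip (pop A u) v.
Proof.
rewrite /pip !big_map mulr_sumr; apply: eq_bigr => a _ /=; rewrite mulr_sumr.
apply: eq_bigr => b _ /=; rewrite hip_scalel -ip_scale.
by rewrite (lin_scale (star_rep_lin s_rep b.2)).
Qed.

Lemma pop_cat A u v : pop A (u ++ v) = pop A u ++ pop A v.
Proof. exact: map_cat. Qed.

Lemma pop_sc A c u : pop A (psc c u) = psc c (pop A u).
Proof. by rewrite /pop /psc -!map_comp. Qed.

Lemma pop_comp A B u : pop (A \o B) u = pop A (pop B u).
Proof. by rewrite /pop -map_comp. Qed.

(** The sum defining the projective cross norm, for one given representative; it depends on the list
    and not only on the tensor. *)
Definition pl1 u : R := \sum_(a <- u) rnorm a.1 * rnorm a.2.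

Lemma pl1_ge0 u : 0 <= pl1 u.
Proof. by apply: sumr_ge0 => a _; rewrite mulr_ge0 ?rnorm_ge0. Qed.

(** This estimate is available before [pip] is known to be positive, hence before its Cauchy-Schwarz
    inequality. *)
Lemma pip_crude u v : rnorm (pip u v) <= 4 * pl1 u * pl1 v.
Proof.
apply: le_trans (rnorm_sum _ _) _; rewrite /pl1 -mulrA mulr_suml mulr_sumr.
apply: ler_sum => a _; apply: le_trans (rnorm_sum _ _) _; rewrite mulrA mulr_sumr.
apply: ler_sum => b _; apply: le_trans (ip_CS _ _) _.
have := le_trans (s_contr (hip a.1 b.1) b.2) (ler_wpM2r (rnorm_ge0 _) (hip_bound _ _)).
move=> /(ler_wpM2l (rnorm_ge0 a.2)) h; apply: le_trans h _.
by rewrite le_eqVlt; apply/orP; left; apply/eqP; ring.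
Qed.

Lemma pl1_pop A C u : (forall x, rnorm (A x) <= C * rnorm x) -> pl1 (pop A u) <= C * pl1 u.
Proof.
move=> AC; rewrite /pl1 big_map mulr_sumr; apply: ler_sum => a _ /=.
by rewrite mulrA ler_wpM2r ?rnorm_ge0.
Qed.

(** * Approximation by lists over a total set *)

Section Approximation.
Variable A0 : set F.
Hypothesis A0_total : Defs.total A0.

Let in_A0 u := {in u, forall a, A0 a.1}.

(** [(sum c_i f_i) (x) h] is replaced by the terms [f_i (x) c_i h]. Lists that represent the same
    tensor are compared only through [pip]. *)
Lemma lspan_expand u : {in u, forall a, lspan A0 a.1} ->
  exists2 v, in_A0 v & forall w, pip u w = pip v w.
Proof.
elim: u => [_|[x h] u IH Au]; first by exists [::].
have [a au|v Av vE] := IH; first by apply: Au; rewrite inE au orbT.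
have [n [c [f [Af xE]]]] : lspan A0 x by apply: (Au (x, h)); rewrite inE eqxx.
exists ([seq (f i, c i *: h) | i <- index_enum 'I_n] ++ v) => [a|w].
  by rewrite mem_cat => /orP[/mapP[i _ ->]|/Av //]; exact: Af.
rewrite pip_catl -vE -[_ :: u]cat1s pip_catl; congr (_ + _).
rewrite /pip big_seq1 big_map exchange_big /=; apply: eq_bigr => b _.
transitivity (ip h (s (\sum_i (c i)^* *: hip (f i) b.1) b.2)).
  congr (ip _ (s _ _)); rewrite xE; elim/big_rec2: _ => [|i y z _ <-]; first exact: hip0l.
  by rewrite hip_addl hip_scalel.
rewrite (lin_sum (star_rep_lin s_rep b.2)) ip_sumr; apply: eq_bigr => i _.
by rewrite (lin_scale (star_rep_lin s_rep b.2)) ip_scale ip_scalel.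
Qed.

Lemma pip_approx u v e : 0 < e -> exists u', [/\ in_A0 u',
  rnorm (pip u v - pip u' v) <= e & rnorm (pip u u - pip u' u') <= e].
Proof.
move=> e0; pose S : R := \sum_(a <- u) rnorm a.2.
have S0 : 0 <= S by apply: sumr_ge0 => a _; rewrite rnorm_ge0.
(* Both errors turn out to be at most [d * C]; the bound [d <= 1] below absorbs the term quadratic
   in [d], and the summand 1 keeps [C] positive. *)
pose C := 4 * S * (pl1 v + 2 * pl1 u + S) + 1.
have C0 : 1 <= C.
  by rewrite /C lerDr !mulr_ge0 ?addr_ge0 // ?mulr_ge0 ?pl1_ge0.
pose d := Num.min 1 (e / C).
have dp : 0 < d by rewrite lt_min ltr01 divr_gt0 //; lra.
have d1 : d <= 1 by rewrite ge_min lexx.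
have dC : d * C <= e by rewrite -ler_pdivlMr ?ge_min ?lexx ?orbT //; lra.
have /choice[phi phiP] : forall x, exists y, lspan A0 y /\ rnorm (x - y) <= d.
  by move=> x; have [y Ay xy] := total_approx A0_total x dp; exists y.
have [|u' Au' u'E] := @lspan_expand (pop phi u).
  by move=> _ /mapP[a _ ->] /=; exact: (phiP a.1).1.
have diff w : rnorm (pip u w - pip u' w) <= 4 * (d * S) * pl1 w.
  have -> : pip u w - pip u' w = pip (pop (fun x => x - phi x) u) w.
    have := pip_popD (fun x => x - phi x) phi u w; rewrite -u'E => E.
    apply/eqP; rewrite subr_eq -E; apply/eqP; congr (pip _ w).
    by rewrite /pop -[LHS]map_id; apply: eq_map => -[x h] /=; rewrite subrK.
  apply: le_trans (pip_crude _ _) _; apply: ler_wpM2r; first exact: pl1_ge0.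
  apply: ler_wpM2l => //; rewrite /pl1 big_map /S mulr_sumr; apply: ler_sum => a _ /=.
  by apply: ler_wpM2r; [exact: rnorm_ge0|exact: (phiP a.1).2].
have pl1phi : pl1 (pop phi u) <= pl1 u + d * S.
  rewrite /pl1 big_map /S mulr_sumr -big_split; apply: ler_sum => a _ /=.
  rewrite -mulrDl; apply: ler_wpM2r; first exact: rnorm_ge0.
  have -> : phi a.1 = a.1 + (phi a.1 - a.1) by rewrite addrC subrK.
  by apply: le_trans (rnormD _ _) _; rewrite lerD2l rnormB (phiP a.1).2.
have dSu : 0 <= d * S * pl1 u by rewrite !mulr_ge0 ?pl1_ge0 // ltW.
have dSv : 0 <= d * S * pl1 v by rewrite !mulr_ge0 ?pl1_ge0 // ltW.
have dSS : 0 <= d * S * S by rewrite !mulr_ge0 // ltW.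
exists u'; split=> //; first by apply: le_trans (diff v) (le_trans _ dC); rewrite /C; lra.
(* One argument is changed at a time. The second change uses that [u'] and [pop phi u] have the same
   inner products. *)
have -> : pip u u - pip u' u' = (pip u u - pip u' u) + (pip u (pop phi u) - pip u' (pop phi u))^*.
  by rewrite rmorphB /= -!pip_conj !u'E addrA subrK.
apply: le_trans (rnormD _ _) (le_trans _ dC); rewrite rnorm_conj.
have := diff u; have := diff (pop phi u).
have : 4 * (d * S) * pl1 (pop phi u) <= 4 * (d * S) * (pl1 u + d * S).
  by apply: ler_wpM2l => //; rewrite !mulr_ge0 // ltW.
have : d * S * (d * S) <= d * S * S.
  by apply: ler_wpM2l; [rewrite mulr_ge0 // ltW|rewrite ler_piMl].
by rewrite /C; lra.
Qed.

Lemma pip_pos_dense : (forall u, in_A0 u -> 0 <= cre (pip u u)) ->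
  forall u, 0 <= cre (pip u u).
Proof.
move=> pos u; rewrite leNgt; apply/negP => u0.
have [|v [/pos v0 _]] := @pip_approx u [::] (- cre (pip u u) / 2); first by lra.
have := cre_le (pip u u - pip v v); rewrite creB.
have := ler_norm (- (cre (pip u u) - cre (pip v v))); rewrite normrN; lra.
Qed.

End Approximation.

(** * The tensor seminorm and bounds for [A (x) 1] *)

Section Seminorm.
Hypothesis pip_pos : forall u, 0 <= cre (pip u u).

Definition pn u : R := Num.sqrt (cre (pip u u)).

Lemma pn_ge0 u : 0 <= pn u.
Proof. exact: sqrtr_ge0. Qed.

Lemma pn_sqr u : pn u ^+ 2 = cre (pip u u).
Proof. exact: sqr_sqrtr. Qed.

Lemma le_pn u C : 0 <= C -> cre (pip u u) <= C ^+ 2 -> pn u <= C.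
Proof. by move=> C0; rewrite -pn_sqr ler_pXn2r ?nnegrE ?pn_ge0. Qed.

Lemma pip_CS u v : rnorm (pip u v) <= pn u * pn v.
Proof.
rewrite -(ler_pXn2r (n := 2)) ?nnegrE ?mulr_ge0 ?rnorm_ge0 ?pn_ge0 // exprMn.
apply: cauchy_schwarz_scalar; rewrite ?sqr_ge0 // => c.
have := pip_pos (u ++ psc c v); rewrite !(pip_catl, pip_catr, pip_scl, pip_scr) mulrA.
rewrite [c^* * c]mulrC mulC_conj !creD creZ !pn_sqr.
by have -> : cre (c^* * pip v u) = cre (c * pip u v); [rewrite [pip v u]pip_conj -rmorphM cre_conj|lra].
Qed.

Lemma pn_cat u v : pn (u ++ v) <= pn u + pn v.
Proof.
apply: le_pn; first by rewrite addr_ge0 ?pn_ge0.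
rewrite pip_catl !pip_catr !creD -!pn_sqr [pip v u]pip_conj cre_conj.
have := le_trans (cre_le_rnorm _) (pip_CS u v); lra.
Qed.

Lemma pn_sc c u : pn (psc c u) = rnorm c * pn u.
Proof.
rewrite /pn pip_scl pip_scr mulrA [c^* * c]mulrC mulC_conj creZ sqrtrM ?sqr_ge0 //.
by rewrite sqrtr_sqr ger0_norm ?rnorm_ge0.
Qed.

Definition pdist u v := pn (u ++ psc (-1) v).

Lemma pdist_ge0 u v : 0 <= pdist u v.
Proof. exact: pn_ge0. Qed.

Lemma pdist_sqr u v :
  pdist u v ^+ 2 = cre (pip u u) - 2 * cre (pip u v) + cre (pip v v).
Proof.
rewrite pn_sqr pip_catl !pip_catr !(pip_scl, pip_scr) rmorphN1 mulrA mulrNN mul1r !mulN1r.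
by rewrite !creD !creN [pip v u]pip_conj cre_conj mul1r; lra.
Qed.

Lemma eq_pn u v : (forall w, pip u w = pip v w) -> pn u = pn v.
Proof. by move=> E; rewrite /pn E pip_conj E -pip_conj. Qed.

Lemma pdist_tri u v w : pdist u w <= pdist u v + pdist v w.
Proof.
apply: le_trans (pn_cat _ _); rewrite le_eqVlt; apply/orP; left; apply/eqP.
by apply: eq_pn => t; rewrite !pip_catl !pip_scl rmorphN1 !mulN1r addrA subrK.
Qed.

Lemma pdistC u v : pdist u v = pdist v u.
Proof.
have -> : pdist u v = rnorm (-1 : Cx R) * pdist u v.
  by rewrite rnormN (rnorm_cof 1) normr1 mul1r.
rewrite -pn_sc; apply: eq_pn => t.
by rewrite !(pip_catl, pip_scl) rmorphN1 mulrDr !mulN1r opprK addrC.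
Qed.

Lemma pdist_cat u v u' v' : pdist (u ++ u') (v ++ v') <= pdist u v + pdist u' v'.
Proof.
apply: le_trans (pn_cat _ _); rewrite le_eqVlt; apply/orP; left; apply/eqP.
by apply: eq_pn => t; rewrite !(pip_catl, pip_scl) mulrDr addrACA.
Qed.

Lemma pdist_sc c u v : pdist (psc c u) (psc c v) = rnorm c * pdist u v.
Proof.
by rewrite -pn_sc; apply: eq_pn => t; rewrite !(pip_catl, pip_scl) mulrDr mulrCA.
Qed.

Lemma pdist_eq u v u' v' : (forall w, pip u w = pip u' w) -> (forall w, pip v w = pip v' w) ->
  pdist u v = pdist u' v'.
Proof. by move=> uE vE; apply: eq_pn => t; rewrite !(pip_catl, pip_scl) uE vE. Qed.

Lemma pn_pdist u v : pn u <= pn v + pdist u v.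
Proof.
apply: le_trans (pn_cat _ _); rewrite le_eqVlt; apply/orP; left; apply/eqP.
by apply: eq_pn => t; rewrite !(pip_catl, pip_scl) rmorphN1 mulN1r addrCA subrr addr0.
Qed.

Definition pbound A C := forall u, pn (pop A u) <= C * pn u.

Lemma pbound_pdist A C u v : pbound A C -> pdist (pop A u) (pop A v) <= C * pdist u v.
Proof. by move=> AC; rewrite /pdist -pop_sc -pop_cat. Qed.

(** [|A^m u|^2 = <u, A^(2m) u> <= |u| |A^(2m) u|], while [pip_crude] gives
    [|A^m u| <= 2 pl1(u) r^m]. By [sqr_growth_le] the constant [2 pl1(u)] disappears. *)
Lemma pbound_selfadjoint A r : 0 < r -> hadjoint A A ->
  (forall x, rnorm (A x) <= r * rnorm x) -> pbound A r.
Proof.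
move=> r0 AA Ar u.
have itAA m : hadjoint (iter m A) (iter m A).
  elim: m => [|m IH] x y; first by [].
  by rewrite iterS AA IH -iterSr.
have itr m x : rnorm (iter m A x) <= r ^+ m * rnorm x.
  elim: m => [|m IH]; first by rewrite mul1r.
  by rewrite iterS exprS -mulrA; apply: le_trans (Ar _) _; rewrite ler_pM2l.
have := @sqr_growth_le R (fun m => pn (pop (iter m A) u)) (2 * pl1 u) r r0.
rewrite /= (_ : pop (iter 0 A) u = u); last first.
  by rewrite /pop -[RHS]map_id; apply: eq_map => -[].
apply=> m; first exact: pn_ge0.
  rewrite pn_sqr (pip_pop _ _ (itAA m)) -pop_comp.
  apply: le_trans (cre_le_rnorm _) (le_trans (pip_CS _ _) _).
  rewrite le_eqVlt; apply/orP; left; apply/eqP; congr (_ * pn (pop _ _)).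
  by apply/funext => x; rewrite -addnn iterD.
apply: le_pn; first by rewrite !mulr_ge0 ?pl1_ge0 // exprn_ge0 // ltW.
apply: le_trans (cre_le_rnorm _) (le_trans (pip_crude _ _) _).
have h := pl1_pop u (itr m).
have := ler_pM (pl1_ge0 _) (pl1_ge0 _) h h; nra.
Qed.

(** The self-adjoint case is applied to [B \o A], bounded by [4 e^2] through [hadjoint_bound]; its
    square root is the constant [2 e]. *)
Lemma pbound_of_bound A B e : 0 < e -> hadjoint A B ->
  (forall x, rnorm (A x) <= e * rnorm x) -> pbound A (2 * e).
Proof.
move=> e0 AB Ae u; pose D := B \o A.
have DD : hadjoint D D by move=> x y; rewrite /D /= (hadjointC AB) AB.
have Dr x : rnorm (D x) <= 4 * e ^+ 2 * rnorm x.
  apply: le_trans (hadjoint_bound (ltW e0) AB Ae _) _.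
  have := Ae x; rewrite -(ler_pM2l e0); lra.
have Dp := pbound_selfadjoint (mulr_gt0 (ltr0Sn _ 3) (exprn_gt0 2 e0)) DD Dr.
apply: le_pn; first by rewrite !mulr_ge0 ?pn_ge0 // ltW.
rewrite (pip_pop _ _ AB) -pop_comp.
apply: le_trans (cre_le_rnorm _) (le_trans (pip_CS _ _) _).
have := ler_wpM2l (pn_ge0 u) (Dp u); lra.
Qed.

(** Since [pip] satisfies the true Cauchy-Schwarz inequality, no constant is lost here, unlike in
    [hadjoint_bound]. *)
Lemma pbound_adjoint A B C : 0 <= C -> hadjoint A B -> pbound A C -> pbound B C.
Proof.
move=> C0 AB AC u; apply: ler_of_sqr_le; rewrite ?pn_ge0 ?mulr_ge0 ?pn_ge0 //.
rewrite pn_sqr (pip_pop _ _ (hadjointC AB)).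
apply: le_trans (cre_le_rnorm _) (le_trans (pip_CS _ _) _).
rewrite mulrC; have := ler_wpM2r (pn_ge0 u) (AC (pop B u)); lra.
Qed.

End Seminorm.
End PreTensor.

(** * Averages of graded lists *)

Section Vanishing.
Variable R : realType.
Implicit Types f g : nat -> R.

(** Only an upper bound is asked; for nonnegative [f] this is convergence to 0. *)
Definition vanish f := forall e : R, 0 < e -> \forall N \near \oo, f N <= e.

Lemma vanish_le f g : (forall N, f N <= g N) -> vanish g -> vanish f.
Proof. by move=> fg vg e /vg; apply: filterS => N; exact: le_trans. Qed.

Lemma vanish_add f g : vanish f -> vanish g -> vanish (fun N => f N + g N).
Proof.
move=> vf vg e e0; have e2 : 0 < e / 2 by lra.
by apply: filterS2 (vf _ e2) (vg _ e2) => N; lra.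
Qed.

Lemma vanish_scale C f : vanish f -> 0 <= C -> vanish (fun N => C * f N).
Proof.
move=> vf C0 e e0; have C1 : 0 < C + 1 by lra.
apply: filterS (vf _ (divr_gt0 e0 C1)) => N; rewrite ler_pdivlMr // => h.
have [f0|f0] := leP 0 (f N); first by lra.
by have := mulr_ge0_le0 C0 (ltW f0); lra.
Qed.

Lemma vanish_rate C f : (forall N, f N <= C / N.+1%:R) -> vanish f.
Proof.
move=> fC e e0; exists (Num.bound (`|C| / e)) => // N /= bN.
apply: le_trans (fC N) _; rewrite ler_pdivrMr ?ltr0Sn //.
have : `|C| / e < (Num.bound (`|C| / e))%:R by apply: archi_boundP; rewrite divr_ge0 // ltW.
rewrite ltr_pdivrMr // => h; apply: le_trans (ler_norm C) (le_trans (ltW h) _).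
by rewrite mulrC ler_pM2l // ler_nat ltnW.
Qed.

Lemma vanish_invS : vanish (fun N => N.+1%:R^-1).
Proof. by apply: (@vanish_rate 1) => N; rewrite div1r. Qed.

Lemma vanish_sqr f : vanish (fun N => f N ^+ 2) -> vanish f.
Proof.
move=> vf e e0; apply: filterS (vf _ (exprn_gt0 2 e0)) => N.
have [f0|f0 _] := leP 0 (f N); first by rewrite ler_pXn2r ?nnegrE // ltW.
by rewrite (le_trans (ltW f0)) ?ltW.
Qed.

Lemma vanish_const (c : R) : vanish (fun=> c) -> c <= 0.
Proof.
move=> vc; apply/ler_addgt0Pr => e /vc; rewrite add0r.
by case=> N _ /(_ N (leqnn N)).
Qed.

Lemma cauchy_limit_rate (V : completeNormedModType (Cx R)) (g : nat -> V) :
  (forall i j, rnorm (g i - g j) <= i.+1%:R^-1 + j.+1%:R^-1) ->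
  exists l, forall i, rnorm (g i - l) <= i.+1%:R^-1.
Proof.
move=> gC; have cg : cauchy (g @ \oo).
  apply/cauchy_ballP => _ /gt0_cof[e e0 ->].
  have [n nP] : exists n : nat, 2 / e < n.+1%:R.
    exists (Num.bound (2 / e)); apply: lt_trans (archi_boundP _) _.
      by rewrite divr_ge0 // ltW.
    by rewrite ltr_nat.
  have small k : (n <= k)%N -> k.+1%:R^-1 < e / 2.
    move=> nk; rewrite -[e / 2]invrK ltf_pV2 ?posrE ?invr_gt0 ?divr_gt0 //.
    by rewrite invf_div (lt_le_trans nP) // ler_nat.
  pose tail : set V := g @` [set k | (n <= k)%N].
  have gtail : (g @ \oo) tail by exists n => // k nk; exists k.
  exists (tail, tail) => // -[_ _] [/= [a na <-] [b nb <-]].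
  rewrite -ball_normE /= rnormE lt_cof; apply: le_lt_trans (gC a b) _.
  by rewrite [e]splitr ltrD ?small.
have {}cg : cvg (g @ \oo) by apply/cauchy_cvgP.
exists (lim (g @ \oo)) => i; apply/ler_addgt0Pr => e e0.
have e2 : 0 < e / 2 by lra.
have ce2 : 0 < cof (e / 2) by rewrite -[0]/(cof 0) lt_cof.
have := filter_ex (filterI ((@cvgrPdist_le _ _ _ _ _ _ _).1 cg _ ce2)
  (vanish_invS e2)).
case=> j [] /=; rewrite rnormE le_cof rnormB => gl je.
have := rnormD (g i - g j) (g j - lim (g @ \oo)); rewrite addrA subrK.
move=> h; apply: le_trans h _; apply: le_trans (lerD (gC i j) gl) _.
by rewrite -addrA lerD2l [leRHS]splitr lerD.
Qed.

End Vanishing.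

(** * Finite sums in a direct sum of copies of [H] indexed by degree *)

Section GradedLists.
Variables (R : realType) (H : hilbert R).
Implicit Types p q : seq (nat * H).

Definition gip p q : Cx R :=
  \sum_(a <- p) \sum_(b <- q) if a.1 == b.1 then ip a.2 b.2 else 0.

Definition component p k : H := \sum_(a <- p | a.1 == k) a.2.

(** With [L = T(x)] this models the action of [S_n(x) (x) 1] after each degree has been mapped to
    [H]. *)
Definition gmap n (L : H -> H) p := [seq ((n + a.1)%N, L a.2) | a <- p].

Lemma gip_component K p q : {in q, forall a, a.1 < K}%N ->
  gip p q = \sum_(k < K) ip (component p k) (component q k).
Proof.
move=> qK; transitivity (\sum_(k < K) \sum_(a <- p | a.1 == k) \sum_(b <- q | b.1 == k) ip a.2 b.2).
  under [RHS]eq_bigr => k _ do rewrite big_mkcond.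
  rewrite exchange_big; apply: eq_bigr => a _ /=.
  under [RHS]eq_bigr => k _.
    rewrite big_mkcond (_ : (if _ then _ else _) =
      \sum_(b <- q) if (a.1 == k) && (b.1 == k) then ip a.2 b.2 else 0); last first.
      by case: ifP => // _; rewrite ?big1.
    over.
  rewrite exchange_big /= big_seq [RHS]big_seq; apply: eq_bigr => b /qK bK.
  rewrite (bigD1 (Ordinal bK)) //= eqxx andbT big1 ?addr0 //.
  move=> k kb; case: eqP => // _; case: eqP => // bk; case/eqP: kb.
  by apply: val_inj; rewrite /= bk.
apply: eq_bigr => k _; rewrite /component ip_suml; apply: eq_bigr => a _.
by rewrite ip_sumr.
Qed.

Lemma component_gmap n (L : H -> H) p k : linear L ->
  component (gmap n L p) k = if (n <= k)%N then L (component p (k - n)%N) else 0.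
Proof.
move=> lL; rewrite /component big_map /=; case: leqP => nk.
  rewrite (lin_sum lL); apply: eq_bigl => a.
  by rewrite -[in LHS](subnKC nk) eqn_add2l.
by rewrite big1 // => a /eqP nak; move: nk; rewrite -nak ltnNge leq_addr.
Qed.

Lemma gip_gmap n L p q : gip (gmap n L p) (gmap n L q) = gip (gmap 0 L p) (gmap 0 L q).
Proof.
rewrite /gip !big_map; apply: eq_bigr => a _; rewrite !big_map; apply: eq_bigr => b _ /=.
by rewrite eqn_add2l.
Qed.

(* At most [n] of the [N + 1] terms are not close to [z]. *)
Lemma average_close (n N : nat) (z : Cx R) (d : R) (f : nat -> Cx R) : 0 <= d ->
  (forall k, (k < n)%N -> f k = 0) ->
  (forall k, (n <= k <= N)%N -> rnorm (f k - z) <= d) ->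
  rnorm (\sum_(k < N.+1) f k - N.+1%:R * z) <= N.+1%:R * d + n%:R * rnorm z.
Proof.
move=> d0 f0 fz.
have -> : \sum_(k < N.+1) f k - N.+1%:R * z = \sum_(k < N.+1) (f k - z).
  by rewrite sumrB sumr_const card_ord mulr_natl.
apply: le_trans (rnorm_sum _ _) _.
apply: (@le_trans _ _ (\sum_(k < N.+1) (d + (if (k < n)%N then rnorm z else 0)))).
  apply: ler_sum => k _; case: ltnP => nk.
    by rewrite f0 // add0r rnormN lerDr.
  by rewrite addr0 fz // nk -ltnS ltn_ord.
rewrite big_split /= sumr_const card_ord mulr_natl lerD2l.
have -> m : \sum_(k < m) (if (k < n)%N then rnorm z else 0) = (minn m n)%:R * rnorm z.
  elim: m => [|m IH]; first by rewrite big_ord0 min0n mul0r.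
  rewrite big_ord_recr IH /=; case: ltnP => mn.
    by rewrite (minn_idPl mn) -natr1 mulrDl mul1r.
  by rewrite addr0 (minn_idPr _) // ltnW.
by rewrite ler_wpM2r ?rnorm_ge0 // ler_nat geq_minr.
Qed.

End GradedLists.

(** * Extension to the Toeplitz algebra *)

Section ToeplitzExtension.
Variables (R : realType) (M : cstar R) (W : setting M) (X : product_system W).
Variables (F : fock_space X) (H : hilbert R) (T : forall n, X n -> H -> H).
Hypothesis T_rep : covariant_rep (@T).
Hypothesis T_iso : forall n (x y : X n) h g,
  ip (T x h) (T y g) = ip h (T (n := 0%N) (hip x y) g).
Hypothesis T_dense : forall k h e, 0 < e -> exists w : seq (X k * H),
  rnorm (\sum_(a <- w) T a.1 a.2 - h) <= e.

Let s : M -> H -> H := T (n := 0%N).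

Let s_rep : star_rep s := rep_star T_rep.

(** The case of 1 by 1 matrices of complete contractivity. *)
Lemma rep0_contractive a h : rnorm (s a h) <= rnorm a * rnorm h.
Proof.
have := @rep_cc _ _ _ _ _ _ T_rep 0%N 1%N (const_mx a) (cof (rnorm a)).
rewrite cof_ge0 rnorm_ge0 => /(_ isT) cc.
have {cc} : op_mx_norm_le (\matrix_(i, j) T (n := 0%N) ((const_mx a : 'M[X 0%N]_1) i j)) (cof (rnorm a)).
  apply: cc => b /=; rewrite !big_ord1 mxE.
  rewrite [leLHS](cnorm_cstar (cmul a (b ord0))) cnorm_cstar !rnormE -!cofX -cofM le_cof -exprMn.
  rewrite ler_pXn2r ?nnegrE ?mulr_ge0 ?rnorm_ge0 //.
  by rewrite -le_cof cofM -!rnormE cnormM.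
move=> /(_ (fun=> h)); rewrite !big_ord1 !mxE !rnormE -!cofX -cofM le_cof -exprMn.
by rewrite ler_pXn2r ?nnegrE ?mulr_ge0 ?rnorm_ge0.
Qed.

Notation FX := (seq ({n : nat & X n} * H)).
Implicit Types (fs gs : FX) (h g : H) (u v : seq (F * H)).

Definition fock_list fs : seq (F * H) := [seq (fock_in F (tagged a.1), a.2) | a <- fs].

(** The image of the tensor under the direct sum of the maps [T_n~]. *)
Definition graded fs : seq (nat * H) := [seq (tag a.1, T (tagged a.1) a.2) | a <- fs].

Definition shift_list n (x : X n) fs : FX :=
  [seq (Tagged (fun n => X n : Type) (psmul x (tagged a.1)), a.2) | a <- fs].

(** By [T_iso] the direct sum of the [T_n~] is isometric, so inner products over the Fock space can
    be computed in copies of [H]. *)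
Lemma pip_fock_list fs gs : pip s (fock_list fs) (fock_list gs) = gip (graded fs) (graded gs).
Proof.
rewrite /pip /gip !big_map; apply: eq_bigr => -[[n x] h] _.
rewrite !big_map; apply: eq_bigr => -[[m y] g] _ /=; case: eqP => [e|/eqP nm].
  by case: m / e y => y; rewrite fock_in_hip T_iso.
by rewrite fock_in_orth // (lin0 (star_rep_lin s_rep g)) ip0r.
Qed.

Lemma pop_fock_list n (x : X n) fs :
  pop (fock_shift F x) (fock_list fs) = fock_list (shift_list x fs).
Proof. by rewrite /pop /fock_list /shift_list -!map_comp; apply: eq_map => a /=; rewrite fock_shift_in. Qed.

Lemma graded_shift_list n (x : X n) fs : graded (shift_list x fs) = gmap n (T x) (graded fs).
Proof. by rewrite /graded /gmap -!map_comp; apply: eq_map => a /=; rewrite (rep_mul T_rep). Qed.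

Let A0 : set F := [set z | exists n (x : X n), z = fock_in F x].

Lemma fock_listP u : {in u, forall a, A0 a.1} -> exists fs, u = fock_list fs.
Proof.
elim: u => [_|[z h] u IH uA]; first by exists [::].
have [n [x zE]] : A0 z by apply: (uA (z, h)); rewrite inE eqxx.
have [a au|fs uE] := IH; first by apply: uA; rewrite inE au orbT.
by exists ((Tagged (fun n => X n : Type) x, h) :: fs); rewrite /= -uE zE.
Qed.

(** The degree bound [K] depends on [p] alone, so the norms before and after applying [L] are sums
    over the same range; a common shift by [n] cancels. *)
Lemma gip_pos (p : seq (nat * H)) : exists K, forall n (L : H -> H), linear L ->
  gip (gmap n L p) (gmap n L p) = cof (\sum_(k < K) rnorm (L (component p k)) ^+ 2).
Proof.
have [K pK] : exists K, {in p, forall a, a.1 < K}%N.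
  elim: p => [|a p [K pK]]; first by exists 0%N.
  exists (maxn a.1.+1 K) => b; rewrite inE => /orP[/eqP->|/pK bK].
    by rewrite leq_maxl.
  by rewrite (leq_trans bK) // leq_maxr.
exists K => n L lL; rewrite gip_gmap (gip_component (K := K)); last first.
  by move=> _ /mapP[a /pK aK ->].
rewrite (big_morph (@cof R) (@cofD R) (erefl _)); apply: eq_bigr => k _.
by rewrite component_gmap // leq0n subn0 ip_rnorm.
Qed.

Lemma gmap0_id (p : seq (nat * H)) : gmap 0 id p = p.
Proof. by rewrite /gmap -[RHS]map_id; apply: eq_map => -[]. Qed.

Lemma fock_pip_pos u : 0 <= cre (pip s u u).
Proof.
move: u; apply: (pip_pos_dense s_rep rep0_contractive (fock_total F)) => _ /fock_listP[fs ->].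
have [K KP] := gip_pos (graded fs).
rewrite pip_fock_list -[graded fs]gmap0_id KP // cre_cof.
by apply: sumr_ge0 => k _; rewrite sqr_ge0.
Qed.

Notation pn := (pn s).
Notation pdist := (pdist s).
Let pos := fock_pip_pos.

(** On lists of homogeneous vectors the shift acts as [T x] on each component. For general [u], with
    [v] the image of [u], the number [<v, v> = <u, B v>] is approximated by replacing [u] with such
    a list. *)
Lemma shift_pbound n (x : X n) C : 0 <= C ->
  (forall h, rnorm (T x h) <= C * rnorm h) -> pbound s (fock_shift F x) C.
Proof.
move=> C0 xC u; have [B SB] := fock_shift_adj F x.
have fin fs : pn (pop (fock_shift F x) (fock_list fs)) <= C * pn (fock_list fs).
  apply: le_pn => //; first by rewrite mulr_ge0 ?pn_ge0.
  have [K KP] := gip_pos (graded fs).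
  rewrite exprMn (pn_sqr pos) pop_fock_list !pip_fock_list graded_shift_list.
  rewrite KP; last exact: (rep_bdd T_rep x).1.
  rewrite -[graded fs]gmap0_id KP // !cre_cof mulr_sumr; apply: ler_sum => k _ /=.
  by rewrite gmap0_id -exprMn ler_pXn2r ?nnegrE ?mulr_ge0 ?rnorm_ge0.
set v := pop (fock_shift F x) u.
apply: ler_of_sqr_le; rewrite ?pn_ge0 ?mulr_ge0 ?pn_ge0 //.
rewrite (pn_sqr pos); apply: le_trans (cre_le_rnorm _) _.
apply/ler_addgt0Pr => e e0; have C1 : 0 < C * pn v + 1 by rewrite ltr_wpDl // mulr_ge0 ?pn_ge0.
(* Approximation within [d^2] changes the seminorm of [u] by at most [d], so the total error is
   [d^2 + C d |v| <= d (C |v| + 1) <= e]. *)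
pose d := Num.min 1 (e / (C * pn v + 1)).
have d0 : 0 < d by rewrite lt_min ltr01 divr_gt0.
have d1 : d <= 1 by rewrite ge_min lexx.
have d2 : d * (C * pn v + 1) <= e by rewrite -ler_pdivlMr // ge_min lexx orbT.
have [u' [/fock_listP[fs ->] uv uu]] :=
  pip_approx s_rep rep0_contractive (fock_total F) u (pop B v) (exprn_gt0 2 d0).
have fsu : pn (fock_list fs) <= pn u + d.
  apply: le_pn => //; first by rewrite addr_ge0 ?pn_ge0 // ltW.
  have := le_trans (ler_norm _) (cre_le (pip s (fock_list fs) (fock_list fs) - pip s u u)).
  rewrite rnormB creB -(pn_sqr pos u) => h.
  have := mulr_ge0 (pn_ge0 s u) (ltW d0); have := le_trans h uu; lra.
rewrite [pip s v v](pip_pop s u v SB); set z := pip s u _ in uv *.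
have -> : z = (z - pip s (fock_list fs) (pop B v)) + pip s (fock_list fs) (pop B v).
  by rewrite subrK.
have := pip_CS s_rep pos (pop (fock_shift F x) (fock_list fs)) v.
rewrite (pip_pop s _ v SB) => cs; apply: le_trans (rnormD _ _) (le_trans (lerD uv cs) _).
have := ler_wpM2r (pn_ge0 s v) (le_trans (fin fs) (ler_wpM2l C0 fsu)).
have : d ^+ 2 <= d by rewrite expr2 ler_piMl // ltW.
lra.
Qed.

(** * Averaged approximate copies of a vector over the degrees 0 to [N] *)

Let invS_gt0 (N : nat) : 0 < N.+1%:R^-1 :> R.
Proof. by rewrite invr_gt0. Qed.

Definition tens k h N : seq (X k * H) := projT1 (cid (T_dense k h (invS_gt0 N))).

Definition block_list h N : FX :=
  flatten [seq [seq (Tagged (fun n => X n : Type) a.1, a.2) | a <- tens k h N] | k <- iota 0 N.+1].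

Lemma component_block_list h N k : (k <= N)%N ->
  rnorm (component (graded (block_list h N)) k - h) <= N.+1%:R^-1.
Proof.
move=> kN; have := projT2 (cid (T_dense k h (invS_gt0 N))); rewrite -/(tens k h N).
suff -> : component (graded (block_list h N)) k = \sum_(a <- tens k h N) T a.1 a.2 by [].
rewrite /component /graded /block_list big_map big_flatten big_map.
rewrite (bigD1_seq k) ?iota_uniq ?mem_iota //= [X in _ + X]big1 ?addr0 => [|j jk].
  by rewrite big_map /= eqxx.
by rewrite big_map /= (negPf jk) big_pred0_eq.
Qed.

Lemma graded_block_list h N : {in graded (block_list h N), forall a, a.1 < N.+1}%N.
Proof.
move=> a /mapP[b /flatten_mapP[k kN /mapP[c _ ->]] ->] /=.
by move: kN; rewrite mem_iota.
Qed.

(* [block h] behaves like [N |-> (N + 1)^-1/2 \sum_(k <= N) (T_k~)^* h], up to an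
   approximation of each [(T_k~)^* h] by a finite sum of elementary tensors. *)
Definition block h N : seq (F * H) :=
  psc (cof (Num.sqrt N.+1%:R)^-1) (fock_list (block_list h N)).

Lemma pip_block A B h g N :
  pip s (pop A (block h N)) (pop B (block g N)) =
  cof (N.+1%:R^-1) * pip s (pop A (fock_list (block_list h N))) (pop B (fock_list (block_list g N))).
Proof.
rewrite !pop_sc (pip_scl s) (pip_scr s_rep) conj_cof mulrA -cofM -invfM -expr2 sqr_sqrtr //.
Qed.

(** In each degree up to [N] the components are close to [h] and [g]. A shift by [n] spoils at most
    [n] of the [N + 1] terms, so the average converges with error of order [1 / (N + 1)]. *)
Lemma graded_limit n (L L' : H -> H) h g : bddlin L -> bddlin L' ->
  vanish (fun N => rnorm (cof (N.+1%:R^-1) * gip (gmap n L (graded (block_list h N)))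
    (gmap 0 L' (graded (block_list g N))) - ip (L h) (L' g))).
Proof.
move=> bL bL'; have [[C C0 LC] [D D0 LD]] := (bddlin_bound bL, bddlin_bound bL').
set z := ip (L h) (L' g).
(* [c] comes from changing [L h] and [L' g] one after the other, with [|L' b| <= |L' g| + D]. *)
pose c := C * (rnorm (L' g) + D) + rnorm (L h) * D.
apply: (vanish_rate (C := c + n%:R * rnorm z)) => N.
set p := graded (block_list h N); set q := graded (block_list g N).
have d0 := invS_gt0 N; set d := N.+1%:R^-1 in d0 *.
have d1 : d <= 1 by rewrite invf_le1 // ler1n.
(* The second list has no degree above [N], so the shifted terms beyond [N] do not contribute. *)
rewrite (gip_component (K := N.+1)); last first.
  by move=> _ /mapP[a /graded_block_list aN ->].
pose f k := ip (component (gmap n L p) k) (component (gmap 0 L' q) k).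
have f0 k : (k < n)%N -> f k = 0.
  by move=> kn; rewrite /f (component_gmap n p k bL.1) leqNgt kn ip0l.
have fz k : (n <= k <= N)%N -> rnorm (f k - z) <= c * d.
  move=> /andP[nk kN]; rewrite /f (component_gmap n p k bL.1) (component_gmap 0 q k bL'.1) nk leq0n subn0.
  set a := component p _; set b := component q _.
  have ha : rnorm (L a - L h) <= C * d.
    rewrite -(lin_opp bL.1) -(lin_add bL.1); apply: le_trans (LC _) _.
    by rewrite ler_wpM2l // component_block_list // (leq_trans (leq_subr _ _)).
  have hb : rnorm (L' b - L' g) <= D * d.
    rewrite -(lin_opp bL'.1) -(lin_add bL'.1); apply: le_trans (LD _) _.
    by rewrite ler_wpM2l // component_block_list.
  have -> : ip (L a) (L' b) - z = ip (L a - L h) (L' b) + ip (L h) (L' b - L' g).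
    by rewrite ip_addl ipNl ip_add ipNr addrA subrK.
  apply: le_trans (rnormD _ _) (le_trans (lerD (ip_CS _ _) (ip_CS _ _)) _).
  have nb : rnorm (L' b) <= rnorm (L' g) + D.
    rewrite -[L' b](subrK (L' g)) addrC; apply: le_trans (rnormD _ _) _.
    by rewrite lerD2l (le_trans hb) // ler_piMr.
  have := ler_pM (rnorm_ge0 _) (rnorm_ge0 _) ha nb.
  have := ler_wpM2l (rnorm_ge0 (L h)) hb; rewrite /c; lra.
have c0 : 0 <= c by rewrite addr_ge0 // !mulr_ge0 ?addr_ge0 ?rnorm_ge0.
have := average_close (mulr_ge0 c0 (ltW d0)) f0 fz.
have dE : cof d * N.+1%:R = 1.
  by rewrite -[N.+1%:R]cof_nat -cofM mulVf.
set S := \sum_(k < _) _; have -> : cof d * S - z = cof d * (S - N.+1%:R * z).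
  by rewrite mulrBr mulrA dE mul1r.
rewrite rnormM rnorm_cof gtr0_norm // => /(ler_wpM2l (ltW d0)) h1.
apply: le_trans h1 _; rewrite le_eqVlt; apply/orP; left; apply/eqP.
have dN : d * N.+1%:R = 1 by rewrite mulVf.
by rewrite mulrDr mulrA dN -/d; ring.
Qed.

Lemma pop_id u : pop id u = u.
Proof. by rewrite /pop -[RHS]map_id; apply: eq_map => -[]. Qed.

Lemma pip_block_limit h g :
  vanish (fun N => rnorm (pip s (block h N) (block g N) - ip h g)).
Proof.
have bid : bddlin (@id H) by apply: (bound_bddlin (C := 1)) => // x; rewrite mul1r.
apply: vanish_le (graded_limit 0 h g bid bid) => N.
by have := pip_block id id h g N; rewrite !pop_id => ->; rewrite pip_fock_list !gmap0_id.
Qed.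

Lemma pip_shift_block_limit n (x : X n) h g :
  vanish (fun N => rnorm (pip s (pop (fock_shift F x) (block h N)) (block g N) - ip (T x h) g)).
Proof.
have bid : bddlin (@id H) by apply: (bound_bddlin (C := 1)) => // y; rewrite mul1r.
apply: vanish_le (graded_limit n h g (rep_bdd T_rep x) bid) => N.
have := pip_block (fock_shift F x) id h g N; rewrite !pop_id => ->.
by rewrite pop_fock_list pip_fock_list graded_shift_list gmap0_id.
Qed.

Lemma pip_shift_shift_block_limit n (x : X n) h g :
  vanish (fun N => rnorm (pip s (pop (fock_shift F x) (block h N)) (pop (fock_shift F x) (block g N))
    - ip (T x h) (T x g))).
Proof.
have bx := rep_bdd T_rep x.
apply: vanish_le (graded_limit 0 h g bx bx) => N.
by rewrite pip_block !pop_fock_list pip_fock_list !graded_shift_list gip_gmap.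
Qed.

(** * Sequences asymptotic to the copy of a vector *)

Lemma pdist_vanish (U V : nat -> seq (F * H)) (a b c : Cx R) :
  vanish (fun N => rnorm (pip s (U N) (U N) - a)) ->
  vanish (fun N => rnorm (pip s (U N) (V N) - b)) ->
  vanish (fun N => rnorm (pip s (V N) (V N) - c)) ->
  cre a - 2 * cre b + cre c = 0 -> vanish (fun N => pdist (U N) (V N)).
Proof.
move=> va vb vc abc; apply: vanish_sqr.
apply: vanish_le (vanish_add (vanish_add va vc) (vanish_scale vb (ler0n R 2))) => N.
rewrite pdist_sqr //.
have := cre_le_rnorm (pip s (U N) (U N) - a); have := cre_le_rnorm (pip s (V N) (V N) - c).
have := cre_le_rnorm (- (pip s (U N) (V N) - b)); rewrite rnormN creN !creB; lra.
Qed.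

Definition tracks (U : nat -> seq (F * H)) h := vanish (fun N => pdist (U N) (block h N)).

Lemma tracks_eq U V h : (forall N w, pip s (U N) w = pip s (V N) w) -> tracks U h -> tracks V h.
Proof. by move=> UV; apply: vanish_le => N; rewrite (pdist_eq (s := s) s_rep (fun w => esym (UV N w)) (fun=> erefl)). Qed.

Lemma tracks_trans U V h : vanish (fun N => pdist (U N) (V N)) -> tracks V h -> tracks U h.
Proof. by move=> UV Vh; apply: vanish_le (vanish_add UV Vh) => N; exact: pdist_tri. Qed.

(** Additivity holds only asymptotically, because the approximating tensors are chosen separately
    for each vector. All inner products involved tend to [|h + g|^2]. *)
Lemma block_add h g : vanish (fun N => pdist (block h N ++ block g N) (block (h + g) N)).
Proof.
have lim2 (z w t : Cx R) (f1 f2 : nat -> Cx R) : z = w + t ->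
    vanish (fun N => rnorm (f1 N - w)) -> vanish (fun N => rnorm (f2 N - t)) ->
    vanish (fun N => rnorm (f1 N + f2 N - z)).
  move=> -> v1 v2; apply: vanish_le (vanish_add v1 v2) => N.
  by rewrite opprD addrACA rnormD.
apply: (pdist_vanish (a := ip (h + g) (h + g)) (b := ip (h + g) (h + g)) (c := ip (h + g) (h + g))).
- under eq_fun do rewrite pip_catl !pip_catr.
  apply: (lim2 _ (ip h (h + g)) (ip g (h + g))); first by rewrite ip_addl.
    by apply: (lim2 _ (ip h h) (ip h g)); rewrite ?ip_add //; exact: pip_block_limit.
  by apply: (lim2 _ (ip g h) (ip g g)); rewrite ?ip_add //; exact: pip_block_limit.
- under eq_fun do rewrite pip_catl.
  by apply: (lim2 _ (ip h (h + g)) (ip g (h + g))); rewrite ?ip_addl //; exact: pip_block_limit.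
- exact: pip_block_limit.
by lra.
Qed.

Lemma vanish_mulC c (z : Cx R) (f : nat -> Cx R) :
  vanish (fun N => rnorm (f N - z)) -> vanish (fun N => rnorm (c * f N - c * z)).
Proof.
move=> fz; apply: vanish_le (vanish_scale fz (rnorm_ge0 c)) => N.
by rewrite -mulrBr rnormM.
Qed.

Lemma block_scale c h : vanish (fun N => pdist (psc c (block h N)) (block (c *: h) N)).
Proof.
have b := pip_block_limit.
apply: (pdist_vanish (a := ip (c *: h) (c *: h)) (b := ip (c *: h) (c *: h)) (c := ip (c *: h) (c *: h))).
- under eq_fun do rewrite (pip_scl s) (pip_scr s_rep) ip_scalel ip_scale.
  by do 2![apply: vanish_mulC].
- by under eq_fun do rewrite (pip_scl s) ip_scalel; apply: vanish_mulC.
- exact: b.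
by lra.
Qed.

Lemma tracks_cat U V h g : tracks U h -> tracks V g -> tracks (fun N => U N ++ V N) (h + g).
Proof.
move=> Uh Vg; apply: tracks_trans (block_add h g).
by apply: vanish_le (vanish_add Uh Vg) => N; exact: pdist_cat.
Qed.

Lemma tracks_sc c U h : tracks U h -> tracks (fun N => psc c (U N)) (c *: h).
Proof.
move=> Uh; apply: tracks_trans (block_scale c h).
by apply: vanish_le (vanish_scale Uh (rnorm_ge0 c)) => N; rewrite pdist_sc.
Qed.

Lemma pdist_block h g : vanish (fun N => `|pdist (block h N) (block g N) ^+ 2 - rnorm (h - g) ^+ 2|).
Proof.
have b := pip_block_limit.
apply: vanish_le (vanish_add (vanish_add (b h h) (b g g)) (vanish_scale (b h g) (ler0n R 2))) => N.
rewrite pdist_sqr // -[rnorm (h - g) ^+ 2]cre_cof -ip_rnorm ip_add !ip_addl !(ipNl, ipNr) !creD !creN.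
rewrite [ip g h]ip_conj cre_conj.
have := cre_le (pip s (block h N) (block h N) - ip h h).
have := cre_le (pip s (block g N) (block g N) - ip g g).
have := cre_le (pip s (block h N) (block g N) - ip h g).
rewrite !creB !ler_norml => /andP[? ?] /andP[? ?] /andP[? ?]; apply/andP; split; lra.
Qed.

Lemma block_dist_le h g e : 0 < e -> \forall N \near \oo, pdist (block h N) (block g N) <= rnorm (h - g) + e.
Proof.
move=> e0; apply: filterS (pdist_block h g (exprn_gt0 2 e0)) => N; rewrite ler_norml => /andP[_ hN].
have h0 := rnorm_ge0 (h - g).
rewrite -(ler_pXn2r (n := 2)) ?nnegrE ?pdist_ge0 ?addr_ge0 ?(ltW e0) //.
have := mulr_ge0 h0 (ltW e0); lra.
Qed.

Lemma le_block_dist h g e : 0 <= e -> (\forall N \near \oo, pdist (block h N) (block g N) <= e) ->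
  rnorm (h - g) <= e.
Proof.
move=> e0 he; rewrite -(ler_pXn2r (n := 2)) ?nnegrE ?rnorm_ge0 //.
apply/ler_addgt0Pr => d d0.
have [N [hN]] := filter_ex (filterI he (pdist_block h g d0)).
rewrite ler_norml => /andP[hd _].
have : pdist (block h N) (block g N) ^+ 2 <= e ^+ 2 by rewrite ler_pXn2r ?nnegrE ?pdist_ge0.
lra.
Qed.

Lemma tracks_uniq U h g : tracks U h -> tracks U g -> h = g.
Proof.
move=> Uh Ug; apply/eqP; rewrite -subr_eq0; apply/eqP/rnorm_eq0/le_anti; rewrite rnorm_ge0 andbT.
apply/ler_addgt0Pr => e e0; rewrite add0r; apply: le_block_dist; first exact: ltW.
have := vanish_add Uh Ug e0; apply: filterS => N; apply: le_trans.
by rewrite [pdist (U N) _]pdistC //; exact: pdist_tri.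
Qed.

(** Blocks recover distances in [H] in the limit, so the approximating vectors form a Cauchy
    sequence; its limit exists by completeness of [H]. *)
Lemma tracks_closed U :
  (forall e, 0 < e -> exists g, \forall N \near \oo, pdist (U N) (block g N) <= e) ->
  exists h, tracks U h.
Proof.
move=> Ug; have /choice[g gP] : forall i : nat, exists g,
    \forall N \near \oo, pdist (U N) (block g N) <= i.+1%:R^-1 by move=> i; exact: Ug.
have [i j|l gl] := @cauchy_limit_rate R H g.
  apply: le_block_dist; first by rewrite addr_ge0 // ltW.
  apply: filterS2 (gP i) (gP j) => N hi hj; rewrite (le_trans (pdist_tri s_rep pos _ (U N) _)) //.
  by rewrite lerD // pdistC.
exists l => e e0; have e3 : 0 < e / 3 by lra.
have /filter_ex[i ie] := vanish_invS e3.
apply: filterS2 (gP i) (block_dist_le (g i) l e3) => N h1 h2.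
apply: le_trans (pdist_tri s_rep pos _ (block (g i) N) _) _.
by move: h1 h2 ie (gl i); set t := _^-1; lra.
Qed.

Lemma tracks_norm U h e : tracks U h -> 0 < e ->
  \forall N \near \oo, pn (U N) <= rnorm h + e.
Proof.
move=> Uh e0; have e2 : 0 < e / 2 by lra.
have : \forall N \near \oo, pn (block h N) <= rnorm h + e / 2.
  have := pip_block_limit h h (exprn_gt0 2 e2); apply: filterS => N hN.
  apply: le_pn => //; first by rewrite addr_ge0 ?rnorm_ge0 // ltW.
  have := le_trans (cre_le_rnorm _) hN; rewrite creB ip_rnorm cre_cof.
  have := mulr_ge0 (rnorm_ge0 h) (ltW e2); lra.
move=> b; apply: filterS2 b (Uh _ e2) => N h1 h2.
by apply: le_trans (pn_pdist s_rep pos _ (block h N)) _; lra.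
Qed.

Lemma tracks_block h : tracks (block h) h.
Proof.
apply: vanish_le (vanish_add (block_scale 1 h) (block_scale 1 h)) => N.
by rewrite [X in X + _]pdistC // scale1r pdist_tri.
Qed.

Lemma tracks_pip U V h g : tracks U h -> tracks V g ->
  vanish (fun N => rnorm (pip s (U N) (V N) - ip h g)).
Proof.
move=> Uh Vg e e0; have e3 : 0 < e / 3 by lra.
have Vn := tracks_norm Vg ltr01; have hn := tracks_norm (tracks_block h) ltr01.
have g1 : 0 < rnorm g + 1 by rewrite ltr_wpDl ?rnorm_ge0.
have h1 : 0 < rnorm h + 1 by rewrite ltr_wpDl ?rnorm_ge0.
have Ue := Uh _ (divr_gt0 e3 g1); have Ve := Vg _ (divr_gt0 e3 h1).
have b1 : \forall N \near \oo, rnorm (pip s (U N ++ psc (-1) (block h N)) (V N)) <= e / 3.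
  apply: filterS2 Vn Ue => N vN; rewrite ler_pdivlMr // => uN.
  apply: le_trans (pip_CS s_rep pos _ _) (le_trans _ uN).
  by apply: ler_wpM2l vN; exact: pdist_ge0.
have b2 : \forall N \near \oo, rnorm (pip s (block h N) (V N ++ psc (-1) (block g N))) <= e / 3.
  apply: filterS2 hn Ve => N bN; rewrite ler_pdivlMr // => uN.
  apply: le_trans (pip_CS s_rep pos _ _) (le_trans _ uN); rewrite mulrC.
  by apply: ler_wpM2l bN; exact: pdist_ge0.
apply: filterS3 b1 b2 (pip_block_limit h g e3) => N p1 p2 p3.
have -> : pip s (U N) (V N) - ip h g =
    pip s (U N ++ psc (-1) (block h N)) (V N) +
    pip s (block h N) (V N ++ psc (-1) (block g N)) + (pip s (block h N) (block g N) - ip h g).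
  rewrite pip_catl pip_catr (pip_scl s) (pip_scr s_rep) rmorphN1 !mulN1r.
  by rewrite !addrA subrK subrK.
apply: le_trans (rnormD _ _) (le_trans (lerD (rnormD _ _) (lexx _)) _); lra.
Qed.

(* [maps A] is the graph of the operator representing [A]. *)
Definition maps (A : F -> F) h g := tracks (fun N => pop A (block h N)) g.

Lemma maps_uniq A h g g' : maps A h g -> maps A h g' -> g = g'.
Proof. exact: tracks_uniq. Qed.

(** [maps] tests [A] on blocks only; boundedness carries it to every sequence tracking [h], as
    composition requires. *)
Lemma maps_tracks A C U h g : 0 <= C -> pbound s A C -> tracks U h -> maps A h g ->
  tracks (fun N => pop A (U N)) g.
Proof.
move=> C0 AC Uh; apply: tracks_trans; apply: vanish_le (vanish_scale Uh C0) => N.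
exact: pbound_pdist.
Qed.

Lemma maps_add A C h h' g g' : 0 <= C -> pbound s A C -> maps A h g -> maps A h' g' ->
  maps A (h + h') (g + g').
Proof.
move=> C0 AC Ah Ah'; apply: tracks_trans (tracks_cat Ah Ah').
apply: vanish_le (vanish_scale (block_add h h') C0) => N.
by rewrite -pop_cat [X in _ <= _ * X]pdistC //; exact: pbound_pdist.
Qed.

Lemma maps_scale A C c h g : 0 <= C -> pbound s A C -> maps A h g -> maps A (c *: h) (c *: g).
Proof.
move=> C0 AC Ah; apply: tracks_trans (tracks_sc c Ah).
apply: vanish_le (vanish_scale (block_scale c h) C0) => N.
by rewrite -pop_sc [X in _ <= _ * X]pdistC //; exact: pbound_pdist.
Qed.

Lemma maps0 A C : 0 <= C -> pbound s A C -> maps A 0 0.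
Proof.
move=> C0 AC; have b0 : tracks (fun=> [::]) 0.
  apply: (pdist_vanish (a := 0) (b := 0) (c := ip 0 0)); last by rewrite ip0l; lra.
  - by move=> e e0; apply: nearW => N; rewrite pip_nill subrr rnorm0 ltW.
  - by move=> e e0; apply: nearW => N; rewrite pip_nill subrr rnorm0 ltW.
  exact: pip_block_limit.
apply: tracks_trans (b0); apply: vanish_le (vanish_scale b0 C0) => N.
by rewrite -[X in pdist _ X <= _]/(pop A [::]) [X in _ <= _ * X]pdistC //; exact: pbound_pdist.
Qed.

Lemma maps_bound A C h h' g g' : 0 <= C -> pbound s A C -> maps A h g -> maps A h' g' ->
  rnorm (g - g') <= C * rnorm (h - h').
Proof.
move=> C0 AC Ah Ah'; apply/ler_addgt0Pr => e e0.
have C1 : 0 < C + 1 by rewrite ltr_wpDl.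
have e2 : 0 < e / 2 by rewrite divr_gt0.
have d0 : 0 < e / 2 / (C + 1) by rewrite divr_gt0.
have dC : C * (e / 2 / (C + 1)) <= e / 2.
  by rewrite mulrC -[leRHS](divfK (lt0r_neq0 C1)) ler_wpM2l ?(ltW d0) // lerDl.
apply: le_block_dist; first by rewrite addr_ge0 ?mulr_ge0 ?rnorm_ge0 // ltW.
apply: filterS2 (vanish_add Ah Ah' e2) (block_dist_le h h' d0) => N h1 h2.
apply: le_trans (pdist_tri s_rep pos _ (pop A (block h N)) _) _.
have := pdist_tri s_rep pos (pop A (block h N)) (pop A (block h' N)) (block g' N).
have := pbound_pdist (block h N) (block h' N) AC.
have := ler_wpM2l C0 h2; rewrite mulrDr [pdist (block g N) _]pdistC //; lra.
Qed.

Lemma maps_shift n (x : X n) h : maps (fock_shift F x) h (T x h).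
Proof.
apply: pdist_vanish (pip_shift_shift_block_limit x h h) (pip_shift_block_limit x h (T x h))
  (pip_block_limit (T x h) (T x h)) _.
by lra.
Qed.

Lemma shift_pbounded n (x : X n) : exists2 C, 0 <= C & pbound s (fock_shift F x) C.
Proof.
have [C C0 xC] := bddlin_bound (rep_bdd T_rep x); exists C => //.
exact: shift_pbound.
Qed.

Lemma maps_closed A C h : 0 <= C -> pbound s A C ->
  (forall e, 0 < e -> exists h' g', rnorm (h - h') <= e /\ maps A h' g') ->
  exists g, maps A h g.
Proof.
move=> C0 AC hP; apply: tracks_closed => e e0.
have C1 : 0 < C + 1 by rewrite ltr_wpDl.
pose d := e / 3 / (C + 1); have d0 : 0 < d by rewrite !divr_gt0.
have dC : d * (C + 1) = e / 3 by rewrite divfK // gt_eqF.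
have [h' [g' [hh' h'g']]] := hP d d0; exists g'.
have e3 : 0 < e / 3 by rewrite divr_gt0.
apply: filterS2 (block_dist_le h h' d0) (h'g' _ e3) => N h1 h2.
apply: le_trans (pdist_tri s_rep pos _ (pop A (block h' N)) _) _.
have := le_trans (pbound_pdist _ _ AC) (ler_wpM2l C0 (le_trans h1 (lerD hh' (lexx d)))).
move=> h3; have := lerD h3 h2; rewrite mulrDr; move: dC; rewrite mulrDr mulr1 mulrC; lra.
Qed.

(** On vectors [T(y) k] the relation [S(x)^* S(y) = S(<x, y>)] forces the value [sigma(<x, y>) k].
    Their span is dense by [T_dense], and the domain of [maps B] is closed. *)
Lemma maps_shift_adj n (x : X n) (B : F -> F) h : hadjoint (fock_shift F x) B ->
  exists g, maps B h g.
Proof.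
move=> SB; have [C C0 xC] := shift_pbounded x.
have BC := pbound_adjoint s_rep pos C0 SB xC.
apply: (maps_closed C0 BC) => e e0; have [w wh] := T_dense n h e0.
exists (\sum_(a <- w) T a.1 a.2), (\sum_(a <- w) s (hip x a.1) a.2).
rewrite rnormB; split=> // {wh}; elim: w => [|[y k] w IH].
  by rewrite !big_nil; exact: maps0 C0 BC.
rewrite !big_cons /=; apply: (maps_add C0 BC _ IH).
have := maps_shift (hip x y : X 0%N) k; rewrite -(shift_adj_shift y SB) => S0.
have yk : vanish (fun N => pdist (block (T y k) N) (pop (fock_shift F y) (block k N))).
  by apply: vanish_le (maps_shift y k) => N; rewrite pdistC.
apply: tracks_trans (S0); apply: vanish_le (vanish_scale yk C0) => N.
by rewrite pop_comp; exact: pbound_pdist.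
Qed.

(** The adjoint is included to make the class self-adjoint, and the bound to make it stable under
    products and norm limits. *)
Definition good (A : F -> F) := exists B C, [/\ hadjoint A B, 0 <= C, pbound s A C,
  forall h, exists g, maps A h g & forall h, exists g, maps B h g].

Lemma good_adj A B : good A -> hadjoint A B -> good B.
Proof.
move=> [B' [C [AB' C0 AC Ag Bg]]] AB; have BE := hadjoint_uniq AB' AB.
exists A, C; split=> //; [exact: hadjointC|exact: pbound_adjoint AB AC|by rewrite -BE].
Qed.

Lemma good_shift n (x : X n) : good (fock_shift F x).
Proof.
have [B SB] := fock_shift_adj F x; have [C C0 xC] := shift_pbounded x.
exists B, C; split=> // h; first by exists (T x h); exact: maps_shift.
exact: maps_shift_adj SB.
Qed.

Lemma mapsD A B h g g' : maps A h g -> maps B h g' -> maps (fun x => A x + B x) h (g + g').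
Proof.
move=> Ag Bg; apply: tracks_eq (tracks_cat Ag Bg) => N w.
by rewrite pip_popD // pip_catl.
Qed.

Lemma mapsZ c A h g : maps A h g -> maps (fun x => c *: A x) h (c *: g).
Proof.
move=> Ag; apply: tracks_eq (tracks_sc c Ag) => N w.
by rewrite pip_popZ // pip_scl.
Qed.

Lemma maps_comp A B C h k g : 0 <= C -> pbound s A C -> maps B h k -> maps A k g ->
  maps (A \o B) h g.
Proof.
move=> C0 AC Bk Ag; have := maps_tracks C0 AC Bk Ag.
by apply: tracks_eq => N w; rewrite pop_comp.
Qed.

Lemma pdist_pop_sub A B u : pdist (pop A u) (pop B u) = pn (pop (fun x => A x - B x) u).
Proof.
apply: (eq_pn s_rep) => w; rewrite pip_catl (pip_scl s) rmorphN1 mulN1r.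
have -> : pop A u = pop (fun x => (A x - B x) + B x) u.
  by apply: eq_map => a; rewrite subrK.
by rewrite (pip_popD s_rep (fun x => A x - B x) B) addrK.
Qed.

Lemma maps_norm_closed A h :
  (forall e, 0 < e -> exists2 B, (exists g, maps B h g) & pbound s (fun x => A x - B x) e) ->
  exists g, maps A h g.
Proof.
move=> AB; apply: tracks_closed => e e0; have h1 : 0 < rnorm h + 1 by rewrite ltr_wpDl ?rnorm_ge0.
have d0 : 0 < e / 2 / (rnorm h + 1) by rewrite !divr_gt0.
have [B [g Bg] ABe] := AB _ d0; exists g; have e2 : 0 < e / 2 by rewrite divr_gt0.
apply: filterS2 (tracks_norm (tracks_block h) ltr01) (Bg _ e2) => N hN gN.
apply: le_trans (pdist_tri s_rep pos _ (pop B (block h N)) _) _.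
rewrite pdist_pop_sub; have := le_trans (ABe (block h N)) (ler_wpM2l (ltW d0) hN).
by rewrite divfK ?gt_eqF //; lra.
Qed.

Lemma good_cstar_subalgebra : cstar_subalgebra good.
Proof.
have goodZ c A : good A -> good (fun x => c *: A x).
  move=> [B [C [AB C0 AC Ag Bg]]]; exists (fun x => c^* *: B x), (rnorm c * C); split.
  - by move=> x y; rewrite hip_scalel hip_scaler AB.
  - by rewrite mulr_ge0 ?rnorm_ge0.
  - move=> u; rewrite (_ : pn _ = pn (psc c (pop A u))).
      by rewrite (pn_sc s_rep) -mulrA ler_wpM2l ?rnorm_ge0.
    by apply: (eq_pn s_rep) => w; rewrite pip_popZ // pip_scl.
  - by move=> h; have [g] := Ag h; exists (c *: g); exact: mapsZ.
  - by move=> h; have [g] := Bg h; exists (c^* *: g); exact: mapsZ.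
split=> //.
- by move=> A [B [C [AB _ _ _ _]]]; exists B.
(* The zero operator is obtained as 0 times a shift. *)
- by have := goodZ 0 _ (good_shift (0 : X 0%N)); under eq_fun do rewrite scale0r.
- move=> A A' [B [C [AB C0 AC Ag Bg]]] [B' [C' [AB' C0' AC' Ag' Bg']]].
  exists (fun x => B x + B' x), (C + C'); split.
  + by move=> x y; rewrite hip_addl hip_addr AB AB'.
  + exact: addr_ge0.
  + move=> u; rewrite mulrDl; apply: le_trans (lerD (AC u) (AC' u)).
    apply: le_trans (pn_cat s_rep pos _ _); rewrite le_eqVlt; apply/orP; left; apply/eqP.
    by apply: (eq_pn s_rep) => w; rewrite pip_popD // pip_catl.
  + by move=> h; have [[g ?] [g' ?]] := (Ag h, Ag' h); exists (g + g'); exact: mapsD.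
  + by move=> h; have [[g ?] [g' ?]] := (Bg h, Bg' h); exists (g + g'); exact: mapsD.
- move=> A A' [B [C [AB C0 AC Ag Bg]]] [B' [C' [AB' C0' AC' Ag' Bg']]].
  have BC := pbound_adjoint s_rep pos C0 AB AC.
  have BC' := pbound_adjoint s_rep pos C0' AB' AC'.
  exists (B' \o B), (C * C'); split.
  + by move=> x y /=; rewrite AB AB'.
  + exact: mulr_ge0.
  + by move=> u; rewrite pop_comp -mulrA; apply: le_trans (AC _) _; rewrite ler_wpM2l.
  + move=> h; have [k A'k] := Ag' h; have [g Ak] := Ag k.
    by exists g; exact: maps_comp C0 AC A'k Ak.
  + move=> h; have [k Bk] := Bg h; have [g B'k] := Bg' k.
    by exists g; exact: maps_comp C0' BC' Bk B'k.
- exact: good_adj.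
move=> A [A' AA'] Aapp.
(* Closeness in operator norm on [F] becomes closeness of [A (x) 1]; the factor 2 of
   [pbound_of_bound] explains [e / 2]. The adjoints are equally close. *)
have {}Aapp e : 0 < e -> exists B B' C, [/\ hadjoint B B', 0 <= C, pbound s B C &
    [/\ forall h, exists g, maps B h g, forall h, exists g, maps B' h g,
       pbound s (fun x => A x - B x) e & pbound s (fun x => A' x - B' x) e]].
  move=> e0; have e2 : 0 < e / 2 by rewrite divr_gt0.
  have ce2 : 0 < cof (e / 2) by rewrite -[0]/(cof 0) lt_cof.
  have [B [B' [C [BB' C0 BC Bg Bg']]] ABe] := Aapp _ ce2.
  have adj : hadjoint (fun x => A x - B x) (fun x => A' x - B' x).
    by move=> x y; rewrite hip_addl hipNl hip_addr hipNr AA' BB'.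
  have b : pbound s (fun x => A x - B x) e.
    rewrite (_ : e = 2 * (e / 2)); last by rewrite mulrC divfK.
    apply: (pbound_of_bound s_rep rep0_contractive pos e2 adj) => x.
    by rewrite -le_cof cofM -!rnormE.
  exists B, B', C; do 2!split=> //; exact: pbound_adjoint (ltW e0) adj b.
(* A single approximant at distance 1 supplies the bound [1 + C] for [A]. *)
have [B [B' [C [BB' C0 BC [Bg Bg' ABb _]]]]] := Aapp 1 ltr01.
exists A', (1 + C); split=> //; first by rewrite addr_ge0.
- move=> u; rewrite mulrDl; apply: le_trans (lerD (ABb u) (BC u)).
  apply: le_trans (pn_cat s_rep pos _ _); rewrite le_eqVlt; apply/orP; left; apply/eqP.
  apply: (eq_pn s_rep) => w; rewrite pip_catl -pip_popD //; congr (pip _ _ w).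
  by apply: eq_map => a; rewrite subrK.
- move=> h; apply: maps_norm_closed => e e0.
  by have [D [D' [? [_ _ _ [Dg _ De _]]]]] := Aapp e e0; exists D.
- move=> h; apply: maps_norm_closed => e e0.
  by have [D [D' [? [_ _ _ [_ Dg _ De]]]]] := Aapp e e0; exists D'.
Qed.

Lemma toeplitz_good A : toeplitz A -> good A.
Proof. by apply; split; [exact: good_cstar_subalgebra|exact: good_shift]. Qed.

(** The default 0 is taken only where no limit exists, which does not happen on the Toeplitz
    algebra. *)
Definition toeplitz_map (A : F -> F) h : H := xget 0 [set g | maps A h g].

Lemma toeplitz_mapP A h : toeplitz A -> maps A h (toeplitz_map A h).
Proof.
move=> /toeplitz_good[B [C [_ _ _ Ag _]]]; rewrite /toeplitz_map.
have [g Ah] := Ag h; exact: (xgetPex 0 (ex_intro _ g Ah)).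
Qed.

Lemma toeplitz_map_shift n (x : X n) : toeplitz_map (fock_shift F x) = T x.
Proof.
apply/funext => h; apply: maps_uniq (maps_shift x h).
by apply: toeplitz_mapP; exact: toeplitz_shift.
Qed.

Lemma toeplitz_map_rep : toeplitz_rep toeplitz_map.
Proof.
split.
- move=> A tA; have [B [C [AB C0 AC _ _]]] := toeplitz_good tA.
  apply: (bound_bddlin (C := C)) => [c h g|h].
    apply: maps_uniq (toeplitz_mapP _ tA) _.
    by apply: (maps_add C0 AC); [apply: (maps_scale _ C0 AC)|]; exact: toeplitz_mapP.
  rewrite -[toeplitz_map A h]subr0 -[in leRHS](subr0 h).
  exact: (maps_bound C0 AC (toeplitz_mapP h tA) (maps0 C0 AC)).
- move=> A B tA tB h; apply: (maps_uniq (toeplitz_mapP h (toeplitz_add tA tB))).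
  by apply: mapsD; exact: toeplitz_mapP.
- move=> c A tA h; apply: (maps_uniq (toeplitz_mapP h (toeplitz_scale c tA))).
  by apply: mapsZ; exact: toeplitz_mapP.
- move=> A B tA tB h; have [_ [C [_ C0 AC _ _]]] := toeplitz_good tA.
  apply: (maps_uniq (toeplitz_mapP h (toeplitz_comp tA tB))).
  by apply: (maps_comp C0 AC); exact: toeplitz_mapP.
- move=> A B tA AB h g; have tB := toeplitz_adj tA AB.
  (* [<A V_N h, V_N g> = <V_N h, B V_N g>] for every [N], and the two sides tend to the two inner
     products being compared. *)
  have := vanish_add (tracks_pip (toeplitz_mapP h tA) (tracks_block g))
    (tracks_pip (tracks_block h) (toeplitz_mapP g tB)).
  set a := ip _ g; set b := ip h _ => ab.
  apply/eqP; rewrite -subr_eq0; apply/eqP/rnorm_eq0/le_anti; rewrite rnorm_ge0 andbT.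
  apply: vanish_const; apply: vanish_le ab => N; rewrite (pip_pop s _ _ AB).
  set z := pip s _ _; have -> : a - b = (z - b) - (z - a) by rewrite opprB [RHS]addrC addrA subrK.
  by rewrite addrC; apply: le_trans (rnormD _ _) _; rewrite rnormN.
(* Nondegeneracy is inherited from [T_0], as the operators [S_0(a)] lie in the Toeplitz algebra. *)
apply/seteqP; split=> // z _; apply: rnorm_closure => e e0.
have [y ys zy] := total_approx (rep_nondegenerate T_rep) z e0; exists y => //.
have [n [c [f [fs ->]]]] := ys; exists n, c, f; split=> // i.
have [a [h ->]] := fs i; exists (fock_shift F (a : X 0%N)); first exact: toeplitz_shift.
by exists h; rewrite toeplitz_map_shift.
Qed.

End ToeplitzExtension.

Theorem proposition4p5 (R : realType) (M : cstar R) (W : setting M)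
    (X : product_system W) (H : hilbert R) (T : forall n, X n -> H -> H)
    (K : forall n, hilbert_tensor (X n) (T 0%N))
    (Tt : forall n, K n -> H) (Ts : forall n, H -> K n)
    (absorb : forall m k, X m -> K k -> K (m + k)%N)
    (Tt_tilde : forall n, is_tilde (Tt n))
    (Ts_adjoint : forall n, adjoint (Tt n) (Ts n))
    (absorb_spec : forall m k, is_absorb (absorb m k))
    (T_coisometric : fully_coisometric_rep Tt Ts) :
  (isometric_rep Tt <->
     forall m : nat, (0 < m)%N -> forall (eta : X m) (h : H),
       (fun l => `|absorb m (l - m)%N eta (Ts (l - m)%N h)|) @ \oo
         --> `|T m eta h|)
  /\ (W = Cstar_setting -> forall F : fock_space X,
        isometric_rep Tt <-> extends_to_toeplitz F T).
Proof.
have T_rep := T_coisometric.1.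
split; first exact: (isometric_iff_limit Tt_tilde Ts_adjoint T_coisometric absorb_spec).
move=> _ F; split=> [[_ iso]|T_ext].
  have T_iso n (x y : X n) h g : ip (T n x h) (T n y g) = ip h (T 0%N (hip x y) g).
    by apply: (isometric_ip Tt_tilde Ts_adjoint T_coisometric) => z; rewrite /rnorm iso.
  (* Density comes from full coisometry; isometry enters through [T_iso]. *)
  have T_dense := coisometric_dense Tt_tilde T_coisometric.
  exists (toeplitz_map (F := F) T_dense); first exact: toeplitz_map_rep.
  by move=> n x; exact: toeplitz_map_shift.
split=> // n z; rewrite !rnormE; congr cof.
apply: (tilde_isometric Tt_tilde Ts_adjoint T_coisometric) => x h.
apply/eqP; rewrite -(eqrXn2 (n := 2)) ?rnorm_ge0 // -[X in X == _]cre_cof -[X in _ == X]cre_cof.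
by rewrite -!ip_rnorm (toeplitz_rep_ip T_ext) ht_ip.
Qed.
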